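(* Let $\mathbb{A}$ be an associative unital algebra over an algebraically closed field $\Bbbk$ of characteristic zero, and let $\llbracket-,-\rrbracket^{(r,s)}:\mathbb{A}^{\otimes r}\otimes \mathbb{A}^{\otimes s}\to \mathbb{A}^{\otimes(r+s)}$ ($r,s\ge 1$) be an $\mathrm{id}$-adapted double transposed Poisson algebra structure on $\mathbb{A}$. Then there is a unique derivation $D\in\operatorname{Der}(\mathbb{A})$ such that $$\llbracket\alpha,\beta\rrbracket^{(r,s)}=\alpha\otimes D(\beta)-D(\alpha)\otimes\beta,\qquad \alpha\in\mathbb{A}^{\otimes r},\ \beta\in\mathbb{A}^{\otimes s},\ r,s\ge 1,$$ where $D$ is extended to each tensor power by the Leibniz rule $D(a^1\otimes\cdots\otimes a^n)=\sum_{k=1}^n a^1\otimes\cdots\otimes D(a^k)\otimes\cdots\otimes a^n$. Moreover, any such structure canonically induces, for every $N\ge 1$, a $\mathrm{GL}_N(\Bbbk)$-equivariant transposed Poisson structure on the representation algebra $\mathbb{A}_N$: the $\Bbbk$-bilinear operation $[-,-]_N:\mathbb{A}_N\times\mathbb{A}_N\to\mathbb{A}_N$ determined by $$[\alpha_{\mathbf i\mathbf j},\beta_{\mathbf k\mathbf l}]_N=\big(\llbracket\alpha,\beta\rrbracket^{(r,s)}\big)_{\mathbf i\sqcup\mathbf k,\ \mathbf j\sqcup\mathbf l}$$ for all $r,s\ge1$, $\alpha\in\mathbb{A}^{\otimes r}$, $\beta\in\mathbb{A}^{\otimes s}$, $\mathbf i,\mathbf j\in\{1,\dots,N\}^r$,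 $\mathbf k,\mathbf l\in\{1,\dots,N\}^s$, is well defined and, together with the commutative product, makes $\mathbb{A}_N$ a transposed Poisson algebra with $g\ast[x,y]_N=[g\ast x,g\ast y]_N$ for all $g\in\mathrm{GL}_N(\Bbbk)$, $x,y\in\mathbb{A}_N$.
   Context: Tensor products are over $\Bbbk$. $\operatorname{Der}(\mathbb{A})$ is the space of $\Bbbk$-linear $D:\mathbb{A}\to\mathbb{A}$ with $D(ab)=aD(b)+D(a)b$. Transposed Poisson algebra: a commutative associative algebra $(A,\cdot)$ with a Lie bracket $[-,-]$ on $A$ such that $2z\cdot[x,y]=[z\cdot x,y]+[x,z\cdot y]$ for all $x,y,z\in A$. Notation on tensor powers. For $1\le u<v\le r$, $\mathrm m_{u,v}:\mathbb{A}^{\otimes r}\to\mathbb{A}^{\otimes(r-1)}$ removes the $u$-th factor $a^u$ and replaces the $v$-th factor $a^v$ by $a^ua^v$. For $0\le\rho\le r$, $b\otimes_\rho(a^1\otimes\cdots\otimes a^r)=a^1\otimes\cdots\otimes a^\rho\otimes b\otimes a^{\rho+1}\otimes\cdots\otimes a^r$ ($b$ is placed first if $\rho=0$). For $\sigma\in S_\ell$, $\tau_\sigma^{m_1,\dots,m_\ell}$ cuts a tensor into consecutive blocks of lengths $m_1,\dots,m_\ell$ and moves the $k$-th block to position $\sigma(k)$, any remaining factors being left in place; e.g. $\tau_{(12)}^{r,s}(\alpha\otimes\beta\otimes\gamma)=\beta\otimes\alpha\otimes\gamma$, $\tau_{(123)}^{r,s,t}(\alpha\otimes\beta\otimes\gamma)=\gamma\otimes\alpha\otimes\beta$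 for $\alpha,\beta,\gamma$ of degrees $r,s,t$. When it acts on a tensor with a first block of length $r$, $\tau_{(23)}^{t,s}$ swaps the second and third blocks, of lengths $t,s$. $\mathrm{id}$-adapted double transposed Poisson algebra: an associative unital algebra $\mathbb{A}$ with $\Bbbk$-linear maps $\llbracket-,-\rrbracket^{(r,s)}:\mathbb{A}^{\otimes r}\otimes\mathbb{A}^{\otimes s}\to\mathbb{A}^{\otimes(r+s)}$, $r,s\ge1$, such that for all $\alpha\in\mathbb{A}^{\otimes r},\beta\in\mathbb{A}^{\otimes s},\gamma\in\mathbb{A}^{\otimes t}$ ($r,s,t\ge1$): (1) $\llbracket\alpha,\beta\rrbracket^{(r,s)}=-\tau_{(12)}^{s,r}\llbracket\beta,\alpha\rrbracket^{(s,r)}$; (2) $\llbracket\alpha,\llbracket\beta,\gamma\rrbracket^{(s,t)}\rrbracket^{(r,s+t)}+\tau_{(123)}^{s,t,r}\llbracket\beta,\llbracket\gamma,\alpha\rrbracket^{(t,r)}\rrbracket^{(s,r+t)}+\tau_{(132)}^{t,r,s}\llbracket\gamma,\llbracket\alpha,\beta\rrbracket^{(r,s)}\rrbracket^{(t,r+s)}=0$; (3) $2\gamma\otimes\llbracket\alpha,\beta\rrbracket^{(r,s)}=\llbracket\gamma\otimes\alpha,\beta\rrbracket^{(t+r,s)}+\tau_{(12)}^{r,t}\llbracket\alpha,\gamma\otimes\beta\rrbracket^{(r,t+s)}$; (4) $2\llbracket\alpha,\beta\rrbracket^{(r,s)}\otimes\gamma=\tau_{(132)}^{t,r,s}\llbracket\gamma\otimes\alpha,\beta\rrbracket^{(t+r,s)}+\tau_{(23)}^{t,s}\llbracket\alpha,\gamma\otimes\beta\rrbracket^{(r,t+s)}$;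 (5) $\llbracket1,\beta\rrbracket^{(1,s)}\in\Bbbk1\otimes\mathbb{A}^{\otimes s}\subset\mathbb{A}^{\otimes(s+1)}$; (6) $\llbracket1\otimes_\rho\alpha,\beta\rrbracket^{(r+1,s)}=1\otimes_\rho\llbracket\alpha,\beta\rrbracket^{(r,s)}$ and $\llbracket\alpha,1\otimes_\varsigma\beta\rrbracket^{(r,s+1)}=1\otimes_{r+\varsigma}\llbracket\alpha,\beta\rrbracket^{(r,s)}$ for $0\le\rho\le r$, $0\le\varsigma\le s$; (7) $\llbracket\mathrm m_{\rho,\rho+1}\alpha,\beta\rrbracket^{(r-1,s)}=\mathrm m_{\rho,\rho+1}\llbracket\alpha,\beta\rrbracket^{(r,s)}$ and $\llbracket\alpha,\mathrm m_{\varsigma,\varsigma+1}\beta\rrbracket^{(r,s-1)}=\mathrm m_{r+\varsigma,r+\varsigma+1}\llbracket\alpha,\beta\rrbracket^{(r,s)}$ for $1\le\rho\le r-1$, $1\le\varsigma\le s-1$; (8) for $m_1,\dots,m_\ell>0$ with sum $s$ and $\sigma\in S_\ell$: $\llbracket\alpha,\tau_\sigma^{m_1,\dots,m_\ell}\beta\rrbracket^{(r,s)}=\tau_{\widehat\sigma}^{r,m_1,\dots,m_\ell}\llbracket\alpha,\beta\rrbracket^{(r,s)}$ and $\llbracket\tau_\sigma^{m_1,\dots,m_\ell}\beta,\alpha\rrbracket^{(s,r)}=\tau_\sigma^{m_1,\dots,m_\ell}\llbracket\beta,\alpha\rrbracket^{(s,r)}$, where $\widehat\sigma=\mathrm{id}_1\times\sigma\in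 S_{\ell+1}$ fixes the first block. Representation algebra: $\mathbb{A}_N=\Bbbk[\operatorname{Rep}_N(\mathbb{A})]$ is the commutative unital algebra generated by $a_{ij}$ ($a\in\mathbb{A}$, $1\le i,j\le N$) with relations $(\lambda a+\mu b)_{ij}=\lambda a_{ij}+\mu b_{ij}$, $1_{ij}=\delta_{ij}$, $(ab)_{ij}=\sum_k a_{ik}b_{kj}$. For $\alpha=a^1\otimes\cdots\otimes a^r$ and multi-indices $\mathbf i,\mathbf j\in\{1,\dots,N\}^r$, $\alpha_{\mathbf i\mathbf j}=a^1_{i_1j_1}\cdots a^r_{i_rj_r}$, extended linearly in $\alpha\in\mathbb{A}^{\otimes r}$; such elements span $\mathbb{A}_N$. $\mathbf i\sqcup\mathbf k$ is concatenation of multi-indices. $\mathrm{GL}_N(\Bbbk)$ acts on $\mathbb{A}_N$ by algebra automorphisms with $g\ast a_{ij}=\sum_{u,v}(g^{-1})_{iu}a_{uv}g_{vj}$. *)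

(* Defs.v *)
(* [boolp] supplies the classical choice and decidability used to form the
   quotient types. *)
From HB Require Import structures.
From mathcomp Require Import all_boot all_order all_fingroup all_algebra.
From mathcomp Require Import boolp generic_quotient.

Set Implicit Arguments.
Unset Strict Implicit.
Unset Printing Implicit Defensive.

Import GRing.Theory.
Local Open Scope ring_scope.
Local Open Scope quotient_scope.

Section Families.
Variable X : Type.

Definition fupd n (t : {ffun 'I_n -> X}) (i : 'I_n) (a : X) : {ffun 'I_n -> X} :=
  [ffun j => if j == i then a else t j].

Definition fcat m n (s : {ffun 'I_m -> X}) (t : {ffun 'I_n -> X}) :
    {ffun 'I_(m + n) -> X} :=
  [ffun i => match split i with inl j => s j | inr j => t j end].

Lemma fupdE n (t : {ffun 'I_n -> X}) i : fupd t i (t i) = t.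
Proof. by apply/ffunP=> j; rewrite ffunE; case: eqP => // ->. Qed.

Lemma fcat_updl m n (s : {ffun 'I_m -> X}) (t : {ffun 'I_n -> X}) i a :
  fcat (fupd s i a) t = fupd (fcat s t) (lshift n i) a.
Proof.
apply/ffunP=> j; rewrite !ffunE -(inj_eq (can_inj (@splitK m n))).
rewrite -[lshift n i]/(unsplit (inl i)) unsplitK.
by case: (split j) => j'; rewrite ?ffunE.
Qed.

Lemma fcat_updr m n (s : {ffun 'I_m -> X}) (t : {ffun 'I_n -> X}) i a :
  fcat s (fupd t i a) = fupd (fcat s t) (rshift m i) a.
Proof.
apply/ffunP=> j; rewrite !ffunE -(inj_eq (can_inj (@splitK m n))).
rewrite -[rshift m i]/(unsplit (inr i)) unsplitK.
by case: (split j) => j'; rewrite ?ffunE.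
Qed.

End Families.

Definition multilinear (k : comNzRingType) (V W : lmodType k) n
    (f : {ffun 'I_n -> V} -> W) : Prop :=
  forall t i, linear (fun a => f (fupd t i a)).

(* V^{(x) n} is presented by generators (pure tensors) and relations: formal
   k-linear expressions in pure tensors, modulo the least congruence containing
   the module axioms and multilinearity. *)

Section TensorPower.
Variables (k : comNzRingType) (V : lmodType k) (n : nat).

Inductive texp : Type :=
| TPure of {ffun 'I_n -> V}
| TZero
| TAdd of texp & texp
| TOpp of texp
| TScale of k & texp.

HB.instance Definition _ := gen_eqMixin texp.
HB.instance Definition _ := gen_choiceMixin texp.

Inductive tcongr : texp -> texp -> Prop :=
| tcongr_refl x : tcongr x x
| tcongr_sym x y : tcongr x y -> tcongr y x
| tcongr_trans x y z : tcongr x y -> tcongr y z -> tcongr x z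
| tcongr_add x x' y y' : tcongr x x' -> tcongr y y' ->
    tcongr (TAdd x y) (TAdd x' y')
| tcongr_opp x x' : tcongr x x' -> tcongr (TOpp x) (TOpp x')
| tcongr_scale c x x' : tcongr x x' -> tcongr (TScale c x) (TScale c x')
| tcongr_addA x y z : tcongr (TAdd x (TAdd y z)) (TAdd (TAdd x y) z)
| tcongr_addC x y : tcongr (TAdd x y) (TAdd y x)
| tcongr_add0 x : tcongr (TAdd TZero x) x
| tcongr_addN x : tcongr (TAdd (TOpp x) x) TZero
| tcongr_scaleA a b x : tcongr (TScale a (TScale b x)) (TScale (a * b) x)
| tcongr_scale1 x : tcongr (TScale 1 x) x
| tcongr_scaleDr c x y :
    tcongr (TScale c (TAdd x y)) (TAdd (TScale c x) (TScale c y))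
| tcongr_scaleDl a b x :
    tcongr (TScale (a + b) x) (TAdd (TScale a x) (TScale b x))
| tcongr_multilin t i c u v :
    tcongr (TPure (fupd t i (c *: u + v)))
           (TAdd (TScale c (TPure (fupd t i u))) (TPure (fupd t i v))).

Definition tequiv (x y : texp) : bool := `[< tcongr x y >].

Lemma tequiv_refl : reflexive tequiv.
Proof. by move=> x; apply/asboolP/tcongr_refl. Qed.

Lemma tequiv_sym : symmetric tequiv.
Proof. by move=> x y; apply/asboolP/asboolP; apply: tcongr_sym. Qed.

Lemma tequiv_trans : transitive tequiv.
Proof.
by move=> y x z /asboolP xy /asboolP yz; apply/asboolP; apply: tcongr_trans yz.
Qed.

Canonical tequiv_equiv := EquivRel tequiv tequiv_refl tequiv_sym tequiv_trans.

Definition tpow := {eq_quot tequiv}.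
HB.instance Definition _ := Choice.on tpow.
HB.instance Definition _ := Quotient.on tpow.

Lemma tpow_eqP x y : \pi_tpow x = \pi_tpow y <-> tcongr x y.
Proof.
have P : reflect (\pi_tpow x = \pi_tpow y) (tequiv_equiv x y) by apply: eqmodP.
by split=> [/P/asboolP|xy]; last apply/P/asboolP.
Qed.

Lemma tpow_eq x y : tcongr x y -> \pi_tpow x = \pi_tpow y.
Proof. by move=> xy; apply/tpow_eqP. Qed.

Lemma tpow_repr x : tcongr (repr (\pi_tpow x)) x.
Proof. by apply/tpow_eqP; rewrite reprK. Qed.

Definition tpow_zero : tpow := lift_cst tpow TZero.
Definition tpow_add := lift_op2 tpow TAdd.
Definition tpow_opp := lift_op1 tpow TOpp.
Definition tpow_scale c := lift_op1 tpow (TScale c).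

Lemma pi_tzero : tpow_zero = \pi_tpow TZero.
Proof. by unlock tpow_zero. Qed.
Lemma pi_tadd x y : tpow_add (\pi_tpow x) (\pi_tpow y) = \pi_tpow (TAdd x y).
Proof.
by unlock tpow_add; apply: tpow_eq; apply: tcongr_add;
  apply: tpow_repr.
Qed.
Lemma pi_topp x : tpow_opp (\pi_tpow x) = \pi_tpow (TOpp x).
Proof.
by unlock tpow_opp; apply: tpow_eq; apply: tcongr_opp;
  apply: tpow_repr.
Qed.
Lemma pi_tscale c x : tpow_scale c (\pi_tpow x) = \pi_tpow (TScale c x).
Proof.
by unlock tpow_scale; apply: tpow_eq; apply: tcongr_scale;
  apply: tpow_repr.
Qed.

Fact tpow_addA : associative tpow_add.
Proof.
elim/quotW=> x; elim/quotW=> y; elim/quotW=> z.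
by rewrite !pi_tadd; apply: tpow_eq; apply: tcongr_addA.
Qed.
Fact tpow_addC : commutative tpow_add.
Proof.
by elim/quotW=> x; elim/quotW=> y; rewrite !pi_tadd; apply: tpow_eq; apply: tcongr_addC.
Qed.
Fact tpow_add0 : left_id tpow_zero tpow_add.
Proof. by elim/quotW=> x; rewrite pi_tzero pi_tadd; apply: tpow_eq; apply: tcongr_add0. Qed.
Fact tpow_addN : left_inverse tpow_zero tpow_opp tpow_add.
Proof. by elim/quotW=> x; rewrite pi_tzero pi_topp pi_tadd; apply: tpow_eq; apply: tcongr_addN. Qed.

HB.instance Definition _ :=
  GRing.isZmodule.Build tpow tpow_addA tpow_addC tpow_add0 tpow_addN.

Fact tpow_scaleA a b x : tpow_scale a (tpow_scale b x) = tpow_scale (a * b) x.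
Proof.
by elim/quotW: x => x; rewrite !pi_tscale; apply: tpow_eq; apply: tcongr_scaleA.
Qed.
Fact tpow_scale1 : left_id 1 tpow_scale.
Proof. by elim/quotW=> x; rewrite !pi_tscale; apply: tpow_eq; apply: tcongr_scale1. Qed.
Fact tpow_scaleDr : right_distributive tpow_scale +%R.
Proof.
move=> c; elim/quotW=> x; elim/quotW=> y; rewrite ![_ + _]pi_tadd !pi_tscale.
by rewrite [RHS]pi_tadd; apply: tpow_eq; apply: tcongr_scaleDr.
Qed.
Fact tpow_scaleDl v : {morph tpow_scale^~ v : a b / a + b}.
Proof.
move=> a b; elim/quotW: v => x; rewrite !pi_tscale [RHS]pi_tadd.
by apply: tpow_eq; apply: tcongr_scaleDl.
Qed.

HB.instance Definition _ := GRing.Zmodule_isLmodule.Build k tpow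
  tpow_scaleA tpow_scale1 tpow_scaleDr tpow_scaleDl.

Lemma tpi0 : \pi_tpow TZero = 0.
Proof. by rewrite -pi_tzero. Qed.
Lemma tpiD x y : \pi_tpow (TAdd x y) = \pi_tpow x + \pi_tpow y.
Proof. by rewrite -pi_tadd. Qed.
Lemma tpiN x : \pi_tpow (TOpp x) = - \pi_tpow x.
Proof. by rewrite -pi_topp. Qed.
Lemma tpiZ c x : \pi_tpow (TScale c x) = c *: \pi_tpow x.
Proof. by rewrite -pi_tscale. Qed.

Definition tpure (t : {ffun 'I_n -> V}) : tpow := \pi_tpow (TPure t).

Lemma tpure_multilinear : multilinear tpure.
Proof.
move=> t i c u v; rewrite /tpure -tpiZ -tpiD.
by apply: tpow_eq; apply: tcongr_multilin.
Qed.

Lemma tpow_ind (P : tpow -> Prop) :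
  (forall t, P (tpure t)) -> P 0 ->
  (forall c x y, P x -> P y -> P (c *: x + y)) -> forall x, P x.
Proof.
move=> Ppure P0 Plin x; rewrite -[x]reprK.
elim: (repr x) => {x} [t||x Px y Py|x Px|c x Px].
- exact: Ppure.
- by rewrite tpi0.
- by rewrite tpiD -[\pi_tpow x]scale1r; apply: Plin.
- by rewrite tpiN -scaleN1r -[_ *: _]addr0; apply: Plin.
- by rewrite tpiZ -[_ *: _]addr0; apply: Plin.
Qed.

Section Lift.
Variables (W : lmodType k) (f : {ffun 'I_n -> V} -> W).

Fixpoint teval (x : texp) : W :=
  match x with
  | TPure t => f t
  | TZero => 0
  | TAdd x y => teval x + teval y
  | TOpp x => - teval x
  | TScale c x => c *: teval x
  end.

(* The linear map induced by a multilinear f; meaningless if f is not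
   multilinear. *)
Definition tlift (x : tpow) : W := teval (repr x).

Hypothesis f_lin : multilinear f.

Lemma teval_congr x y : tcongr x y -> teval x = teval y.
Proof.
elim=> {x y} //=; try by move=> *; congruence.
- by move=> *; rewrite addrA.
- by move=> *; rewrite addrC.
- by move=> *; rewrite add0r.
- by move=> *; rewrite addNr.
- by move=> *; rewrite scalerA.
- by move=> *; rewrite scale1r.
- by move=> *; rewrite scalerDr.
- by move=> *; rewrite scalerDl.
Qed.

Lemma tlift_pi x : tlift (\pi_tpow x) = teval x.
Proof. exact/teval_congr/tpow_repr. Qed.

Lemma tlift_pure t : tlift (tpure t) = f t.
Proof. exact: tlift_pi. Qed.

Lemma tlift_linear : linear tlift.
Proof.
move=> c; elim/quotW=> x; elim/quotW=> y.
by rewrite -tpiZ -tpiD !tlift_pi.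
Qed.

Lemma tlift0 : tlift 0 = 0.
Proof. by rewrite -tpi0 tlift_pi. Qed.

Lemma tlift_unique (g : tpow -> W) :
  linear g -> (forall t, g (tpure t) = f t) -> g =1 tlift.
Proof.
move=> g_lin gE; apply: tpow_ind => [t||c x y IHx IHy].
- by rewrite gE tlift_pure.
- rewrite tlift0; have := g_lin (-1) 0 0.
  by rewrite !scaleN1r !addNr.
- by rewrite g_lin tlift_linear IHx IHy.
Qed.

End Lift.

End TensorPower.

Arguments tpure {k V n} t.

Definition tcast (k : comNzRingType) (V : lmodType k) m n (e : m = n)
    (x : tpow V m) : tpow V n := ecast i (tpow V i) e x.

Section ModuleOperations.
Variables (k : comNzRingType) (V : lmodType k).

Definition tens m n (x : tpow V m) (y : tpow V n) : tpow V (m + n) :=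
  tlift (fun s => tlift (fun t => tpure (fcat s t)) y) x.

Lemma tens_multilinear_r m n (s : {ffun 'I_m -> V}) :
  multilinear (fun t : {ffun 'I_n -> V} => tpure (fcat s t)).
Proof. by move=> t i c u v; rewrite !fcat_updr; apply: tpure_multilinear. Qed.

Lemma tens_multilinear_l m n (y : tpow V n) :
  multilinear (fun s : {ffun 'I_m -> V} => tlift (fun t => tpure (fcat s t)) y).
Proof.
move=> s i c u v; elim/tpow_ind: y => [t||d x y IHx IHy].
- rewrite !tlift_pure; try exact: tens_multilinear_r.
  by rewrite !fcat_updl; apply: tpure_multilinear.
- by rewrite !(tlift0 (tens_multilinear_r _)) scaler0 addr0.
- rewrite !(tlift_linear (tens_multilinear_r _)) IHx IHy !scalerDr !scalerA.
  by rewrite (mulrC d c) addrACA.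
Qed.

Lemma tens_pure m n (s : {ffun 'I_m -> V}) (t : {ffun 'I_n -> V}) :
  tens (tpure s) (tpure t) = tpure (fcat s t).
Proof.
rewrite /tens tlift_pure; last exact: tens_multilinear_l.
exact: tlift_pure (tens_multilinear_r s) t.
Qed.

Lemma tens_bilinear m n : bilinear_for *:%R *:%R (@tens m n).
Proof.
split=> [y|x]; first exact/tlift_linear/tens_multilinear_l.
move=> c y z; elim/tpow_ind: x => [s||d u v IHu IHv].
- rewrite /tens !tlift_pure; try exact: tens_multilinear_l.
  exact/tlift_linear/tens_multilinear_r.
- by rewrite /tens !(tlift0 (tens_multilinear_l _)) addr0 /= scaler0.
- have L w : tens (d *: u + v) w = d *: tens u w + tens v w.
    exact/tlift_linear/tens_multilinear_l.
  by rewrite !L IHu IHv /= !scalerDr !scalerA (mulrC d c) addrACA.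
Qed.

(* b (x)_p -, for 0 <= p <= n. *)
Definition tins n (p : nat) (b : V) : tpow V n -> tpow V n.+1 :=
  tlift (fun t : {ffun 'I_n -> V} => tpure
    [ffun i : 'I_n.+1 => if unlift (inord p) i is Some j then t j else b]).

Lemma tins_multilinear n p (b : V) : multilinear (fun t : {ffun 'I_n -> V} =>
  tpure [ffun i : 'I_n.+1 => if unlift (inord p) i is Some j then t j else b]).
Proof.
move=> t i c u v; have E a :
  [ffun h : 'I_n.+1 => if unlift (inord p) h is Some j then fupd t i a j else b]
  = fupd [ffun h : 'I_n.+1 => if unlift (inord p) h is Some j then t j else b]
      (lift (inord p) i) a.
  apply/ffunP=> h; rewrite !ffunE; case: unliftP => [j ->|->].
    by rewrite ffunE (inj_eq lift_inj).
  by rewrite (negPf (neq_lift _ _)).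
by rewrite !E; apply: tpure_multilinear.
Qed.

Lemma tins_pure n p (b : V) (t : {ffun 'I_n -> V}) :
  tins p b (tpure t) = tpure
    [ffun i : 'I_n.+1 => if unlift (inord p) i is Some j then t j else b].
Proof. exact/tlift_pure/tins_multilinear. Qed.

End ModuleOperations.

(* Block permutations: the word x is cut into blocks of lengths ms, the a-th
   block is moved to position s a, and the letters beyond the last block stay
   at the end. *)
Definition blkseq (X : Type) l (ms : l.-tuple nat) (s : 'S_l) (x : seq X) :
    seq X :=
  flatten [seq nth [::] (reshape ms x) (s^-1%g a) | a <- enum 'I_l]
  ++ drop (sumn ms) x.

Section BlockPermutation.
Variables (l : nat) (ms : l.-tuple nat) (s : 'S_l).

Lemma perm_blkseq (X : eqType) (x : seq X) : perm_eq (blkseq ms s x) x.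
Proof.
have /permPl-> : perm_eq (blkseq ms s x)
    (flatten (reshape ms x) ++ drop (sumn ms) x).
  rewrite perm_cat2r; apply: perm_flatten.
  set bs := reshape ms x.
  have sz : size bs = l by rewrite size_reshape size_tuple.
  have {2}-> : bs = [seq nth [::] bs a | a : 'I_l <- enum 'I_l].
    by rewrite (map_comp (nth [::] bs) val) val_enum_ord map_nth_iota0 -?sz //
      take_size.
  rewrite (map_comp (fun a : 'I_l => nth [::] bs a) (s^-1)%g).
  apply: perm_map; apply: uniq_perm; last 1 first.
  - move=> a; rewrite mem_enum; apply/mapP; exists (s a); rewrite ?mem_enum //.
    by rewrite permK.
  - by rewrite map_inj_uniq ?enum_uniq //; apply: perm_inj.
  - exact: enum_uniq.
suff -> : flatten (reshape ms x) = take (sumn ms) x by rewrite cat_take_drop.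
elim: (tval ms) x => [|m r IH] x /=; first by rewrite take0.
by rewrite IH takeD.
Qed.

Definition blksrc n (i : 'I_n) : 'I_n := nth i (blkseq ms s (enum 'I_n)) i.

Lemma blksrc_inj n : injective (@blksrc n).
Proof.
move=> i j; rewrite /blksrc; set L := blkseq _ _ _.
have P : perm_eq L (enum 'I_n) by apply: perm_blkseq.
have szL : size L = n by rewrite (perm_size P) size_enum_ord.
have uL : uniq L by rewrite (perm_uniq P) enum_uniq.
rewrite (set_nth_default i j) ?szL // => /eqP.
by rewrite nth_uniq ?szL // => /eqP/val_inj.
Qed.

Section Linear.
Variables (k : comNzRingType) (V : lmodType k) (n : nat).

Definition tblk : tpow V n -> tpow V n :=
  tlift (fun t : {ffun 'I_n -> V} => tpure [ffun i => t (blksrc i)]).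

Lemma tblk_multilinear :
  multilinear (fun t : {ffun 'I_n -> V} => tpure [ffun i => t (blksrc i)]).
Proof.
move=> t i c u v; have [g gK Kg] := injF_bij (@blksrc_inj n).
have E a : [ffun j => fupd t i a (blksrc j)]
           = fupd [ffun j => t (blksrc j)] (g i) a.
  by apply/ffunP=> j; rewrite !ffunE (can2_eq gK Kg).
by rewrite !E; apply: tpure_multilinear.
Qed.

Lemma tblk_pure (t : {ffun 'I_n -> V}) :
  tblk (tpure t) = tpure [ffun i => t (blksrc i)].
Proof. exact/tlift_pure/tblk_multilinear. Qed.

Lemma tblk_linear : linear tblk.
Proof. exact/tlift_linear/tblk_multilinear. Qed.

End Linear.
End BlockPermutation.

(* (12) in S_2; (123) and (23) in S_3, on the indices 0, 1, 2. *)
Definition sw12 : 'S_2 := tperm ord0 ord_max.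
Definition cyc123 : 'S_3 := perm (@ordS_inj 3).
Definition cyc132 : 'S_3 := cyc123^-1%g.
Definition sw23 : 'S_3 := tperm (inord 1) ord_max.

Section BlockExamples.
Variables (X : Type) (x y z w : seq X).
Let m := size x.
Let n := size y.
Let p := size z.

Let enum3 : enum 'I_3 = [:: ord0; inord 1; ord_max].
Proof.
by apply: (inj_map val_inj); rewrite val_enum_ord /= inordK.
Qed.

Let enum2 : enum 'I_2 = [:: ord0; ord_max].
Proof. by apply: (inj_map val_inj); rewrite val_enum_ord. Qed.

Lemma blkseq_sw12 : blkseq [tuple m; n] sw12 (x ++ y ++ w) = y ++ x ++ w.
Proof.
rewrite /blkseq enum2 /= tpermV tpermL tpermR /=.
have dw : drop (m + n) (x ++ y ++ w) = w.
  by rewrite catA drop_size_cat ?size_cat.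
by rewrite addn0 dw take_size_cat // drop_size_cat // take_size_cat //
  cats0 -catA.
Qed.

Lemma blkseq_cyc123 :
  blkseq [tuple m; n; p] cyc123 (x ++ y ++ z ++ w) = z ++ x ++ y ++ w.
Proof.
have V0 : (cyc123^-1)%g ord0 = ord_max.
  by apply: (@perm_inj _ cyc123); rewrite permKV permE; apply: val_inj.
have V1 : (cyc123^-1)%g (inord 1) = ord0.
  by apply: (@perm_inj _ cyc123); rewrite permKV permE; apply: val_inj;
     rewrite /= inordK.
have V2 : (cyc123^-1)%g ord_max = inord 1.
  by apply: (@perm_inj _ cyc123); rewrite permKV permE; apply: val_inj;
     rewrite /= inordK.
have dw : drop (m + (n + p)) (x ++ y ++ z ++ w) = w.
  by rewrite !catA drop_size_cat // !size_cat -addnA.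
rewrite /blkseq enum3 /= V0 V1 V2 /= inordK //= addn0 dw.
rewrite take_size_cat // drop_size_cat // take_size_cat // drop_size_cat //.
by rewrite take_size_cat // cats0 -!catA.
Qed.

Lemma blkseq_cyc132 :
  blkseq [tuple m; n; p] cyc132 (x ++ y ++ z ++ w) = y ++ z ++ x ++ w.
Proof.
have V0 : cyc123 ord0 = inord 1.
  by rewrite permE; apply: val_inj; rewrite /= inordK.
have V1 : cyc123 (inord 1) = ord_max.
  by rewrite permE; apply: val_inj; rewrite /= inordK.
have V2 : cyc123 ord_max = ord0.
  by rewrite permE; apply: val_inj.
have dw : drop (m + (n + p)) (x ++ y ++ z ++ w) = w.
  by rewrite !catA drop_size_cat // !size_cat -addnA.
rewrite /blkseq /cyc132 invgK enum3 /= V0 V1 V2 /= inordK //= addn0 dw.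
rewrite take_size_cat // drop_size_cat // take_size_cat // drop_size_cat //.
by rewrite take_size_cat // cats0 -!catA.
Qed.

Lemma blkseq_sw23 :
  blkseq [tuple m; n; p] sw23 (x ++ y ++ z ++ w) = x ++ z ++ y ++ w.
Proof.
have V0 : sw23 ord0 = ord0.
  by apply: tpermD; rewrite -val_eqE /= ?inordK.
have dw : drop (m + (n + p)) (x ++ y ++ z ++ w) = w.
  by rewrite !catA drop_size_cat // !size_cat -addnA.
rewrite /blkseq enum3 /= tpermV -/sw23 V0 tpermL tpermR /= inordK //= addn0 dw.
rewrite take_size_cat // drop_size_cat // take_size_cat // drop_size_cat //.
by rewrite take_size_cat // cats0 -!catA.
Qed.

End BlockExamples.

Section AlgebraOperations.
Variables (k : comNzRingType) (A : algType k).

Definition tone : tpow A 1 := tpure [ffun=> 1].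

(* [bump u i] is the position in t of the factor at position i once factor u is
   removed; factors are numbered from 0. *)
Definition mulfam n (u v : nat) (t : {ffun 'I_n.+1 -> A}) : {ffun 'I_n -> A} :=
  [ffun i : 'I_n =>
    if bump u i == v then t (inord u) * t (inord v) else t (inord (bump u i))].

(* m_{u,v}, for 0 <= u < v <= n. *)
Definition tmulfac n (u v : nat) : tpow A n.+1 -> tpow A n :=
  tlift (fun t : {ffun 'I_n.+1 -> A} => tpure (mulfam u v t)).

Lemma tmulfac_multilinear n u v : (u < v <= n)%N ->
  multilinear (fun t : {ffun 'I_n.+1 -> A} => tpure (mulfam u v t)).
Proof.
case/andP=> uv vn t h c x y.
have un : (u <= n)%N by apply: leq_trans vn; apply: ltnW.
set F := mulfam u v.
have bn (i : 'I_n) : (bump u i < n.+1)%N.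
  by rewrite /bump ltnS; case: (u <= i)%N; rewrite ?add1n ?add0n // ltnW.
have n0 : (0 < n)%N by apply: leq_trans vn; apply: leq_ltn_trans uv.
have v0 : (0 < v)%N by apply: leq_ltn_trans uv.
have v1n : (v.-1 < n)%N by rewrite prednK.
pose iv : 'I_n := Ordinal v1n.
have bv (i : 'I_n) : (bump u i == v) = (i == iv).
  have vE : bump u v.-1 = v by rewrite /bump -ltnS prednK // uv add1n prednK.
  by rewrite -{1}vE (can_eq (bumpK u)).
have uvN : (inord u : 'I_n.+1) != inord v.
  by rewrite -val_eqE /= !inordK // neq_ltn uv.
have other (i : 'I_n) : i != iv ->
    ((inord (bump u i) : 'I_n.+1) == inord u = false) *
    ((inord (bump u i) : 'I_n.+1) == inord v = false).
  move=> Ni; split; rewrite -val_eqE /= !inordK //; last by rewrite bv (negPf Ni).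
  by rewrite eq_sym (negPf (neq_bump _ _)).
have Euv a : (h == inord u) || (h == inord v) ->
  F (fupd t h a) = fupd (F t) iv
    (if h == inord u then a * t (inord v) else t (inord u) * a).
  move=> hh; apply/ffunP=> i; rewrite !ffunE bv.
  case: eqVneq => [_|Ni].
    move: hh; case: (eqVneq h (inord u)) => [->|Nhu] /= => [_|/eqP->].
      by rewrite eq_sym (negPf uvN).
    by rewrite eqxx.
  by case/orP: hh => /eqP->; rewrite !(other i Ni).
case: (boolP ((h == inord u) || (h == inord v))) => [hh|].
  rewrite /= -/(F _) -/(F (fupd t h x)) -/(F (fupd t h y)) !Euv //.
  case: ifP => _; rewrite ?mulrDl ?mulrDr -?scalerAl -?scalerAr;
    exact: tpure_multilinear.
rewrite negb_or => /andP[hu hv].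
have hub : ~~ (val h == u).
  by apply: contra hu => /eqP hE; rewrite -val_eqE /= inordK // hE.
have hK : bump u (unbump u h) = h by rewrite unbumpK // !inE.
have hn : (unbump u h < n)%N.
  have := ltn_ord h; rewrite ltnS /unbump.
  case: (ltngtP u h) hub => //= [uh _|hu' _ _].
    by rewrite subn1 => hn; rewrite prednK // (leq_ltn_trans _ uh).
  by rewrite subn0; apply: leq_trans un.
pose ih : 'I_n := Ordinal hn.
have E a : F (fupd t h a) = fupd (F t) ih a.
  apply/ffunP=> i; rewrite !ffunE bv ![inord _ == h]eq_sym (negPf hu) (negPf hv).
  have iih : (h == inord (bump u i)) = (i == ih).
    rewrite -val_eqE /= inordK // -[in LHS]hK (can_eq (@bumpK u)).
    by rewrite eq_sym.
  rewrite iih; case: (eqVneq i ih) => [->|//].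
  case: eqVneq => // e; move: hv; rewrite -val_eqE /= inordK //.
  by rewrite -hK -[unbump u h]/(val ih) bv e eqxx.
by rewrite /= -/(F _) -/(F (fupd t h x)) -/(F (fupd t h y)) !E;
   apply: tpure_multilinear.
Qed.

Lemma tmulfac_pure n u v (t : {ffun 'I_n.+1 -> A}) : (u < v <= n)%N ->
  tmulfac u v (tpure t) = tpure (mulfam u v t).
Proof. by move=> uv; apply/tlift_pure/tmulfac_multilinear. Qed.

Definition derivation (D : A -> A) : Prop :=
  linear D /\ forall a b, D (a * b) = a * D b + D a * b.

Definition tder (D : A -> A) n : tpow A n -> tpow A n :=
  tlift (fun t : {ffun 'I_n -> A} => \sum_(i < n) tpure (fupd t i (D (t i)))).

Lemma tder_multilinear D n : linear D ->
  multilinear (fun t : {ffun 'I_n -> A} =>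
    \sum_(i < n) tpure (fupd t i (D (t i)))).
Proof.
move=> Dlin t h c x y; rewrite scaler_sumr -big_split /=; apply: eq_bigr => i _.
have [->|Nih] := eqVneq i h.
  have E a : fupd (fupd t h a) h (D (fupd t h a h)) = fupd t h (D a).
    by apply/ffunP=> j; rewrite !ffunE eqxx; case: eqP.
  by rewrite !E Dlin; apply: tpure_multilinear.
have E a : fupd (fupd t h a) i (D (fupd t h a i))
           = fupd (fupd t i (D (t i))) h a.
  apply/ffunP=> j; rewrite !ffunE (negPf Nih).
  by case: (eqVneq j i) => // ->; rewrite (negPf Nih).
by rewrite !E; apply: tpure_multilinear.
Qed.

Lemma tder_pure D n (t : {ffun 'I_n -> A}) : linear D ->
  tder D (tpure t) = \sum_(i < n) tpure (fupd t i (D (t i))).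
Proof. by move=> Dlin; apply/tlift_pure/tder_multilinear. Qed.

End AlgebraOperations.

Arguments tone {k A}.

(* The values of the family at r = 0 or s = 0 are unconstrained and never
   used.  In [dtp_insl] ... [dtp_mulr] factors are numbered from 0, and in
   [dtp_mull] (resp. [dtp_mulr]) the degree of alpha (resp. beta) is written
   as a successor, so that m lands in degree r (resp. s) >= 1. *)

Record id_adapted_dtp (k : comNzRingType) (A : algType k)
    (br : forall r s : nat, tpow A r -> tpow A s -> tpow A (r + s)) : Prop := {
  dtp_bilinear : forall r s, (0 < r)%N -> (0 < s)%N ->
    bilinear_for *:%R *:%R (br r s);
  dtp_skew : forall r s (al : tpow A r) (be : tpow A s),
    (0 < r)%N -> (0 < s)%N ->
    br r s al be
    = - tcast (addnC s r) (tblk [tuple s; r] sw12 (br s r be al));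
  dtp_jacobi : forall r s t (al : tpow A r) (be : tpow A s) (ga : tpow A t),
    (0 < r)%N -> (0 < s)%N -> (0 < t)%N ->
    br r (s + t)%N al (br s t be ga)
    + tcast (etrans (addnA s t r) (addnC (s + t) r))
        (tblk [tuple s; t; r] cyc123 (br s (t + r)%N be (br t r ga al)))
    + tcast (etrans (addnC t (r + s)) (esym (addnA r s t)))
        (tblk [tuple t; r; s] cyc132 (br t (r + s)%N ga (br r s al be)))
    = 0;
  dtp_tensl : forall r s t (al : tpow A r) (be : tpow A s) (ga : tpow A t),
    (0 < r)%N -> (0 < s)%N -> (0 < t)%N ->
    tens ga (br r s al be) *+ 2
    = tcast (esym (addnA t r s)) (br (t + r)%N s (tens ga al) be)
    + tcast (addnCA r t s)
        (tblk [tuple r; t] sw12 (br r (t + s)%N al (tens ga be)));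
  dtp_tensr : forall r s t (al : tpow A r) (be : tpow A s) (ga : tpow A t),
    (0 < r)%N -> (0 < s)%N -> (0 < t)%N ->
    tens (br r s al be) ga *+ 2
    = tcast (etrans (esym (addnA t r s)) (addnC t (r + s)))
        (tblk [tuple t; r; s] cyc132 (br (t + r)%N s (tens ga al) be))
    + tcast (etrans (addnA r t s) (addnAC r t s))
        (tblk [tuple r; t; s] sw23 (br r (t + s)%N al (tens ga be)));
  dtp_one : forall s (be : tpow A s), (0 < s)%N ->
    exists x : tpow A s, br 1 s tone be = tens tone x;
  dtp_insl : forall r s p (al : tpow A r) (be : tpow A s),
    (0 < r)%N -> (0 < s)%N -> (p <= r)%N ->
    tcast (addSn r s) (br r.+1 s (tins p 1 al) be) = tins p 1 (br r s al be);
  dtp_insr : forall r s q (al : tpow A r) (be : tpow A s),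
    (0 < r)%N -> (0 < s)%N -> (q <= s)%N ->
    tcast (addnS r s) (br r s.+1 al (tins q 1 be))
    = tins (r + q) 1 (br r s al be);
  dtp_mull : forall r s p (al : tpow A r.+1) (be : tpow A s),
    (0 < s)%N -> (p < r)%N ->
    br r s (tmulfac p p.+1 al) be
    = tmulfac p p.+1 (tcast (addSn r s) (br r.+1 s al be));
  dtp_mulr : forall r s q (al : tpow A r) (be : tpow A s.+1),
    (0 < r)%N -> (q < s)%N ->
    br r s al (tmulfac q q.+1 be)
    = tmulfac (r + q) (r + q).+1 (tcast (addnS r s) (br r s.+1 al be));
  dtp_blkr : forall r s l (ms : l.-tuple nat) (sg : 'S_l)
      (al : tpow A r) (be : tpow A s),
    (0 < r)%N -> (0 < s)%N -> all (leq 1) ms -> sumn ms = s ->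
    br r s al (tblk ms sg be)
    = tblk [tuple of r :: ms] (lift_perm ord0 ord0 sg) (br r s al be);
  dtp_blkl : forall r s l (ms : l.-tuple nat) (sg : 'S_l)
      (al : tpow A r) (be : tpow A s),
    (0 < r)%N -> (0 < s)%N -> all (leq 1) ms -> sumn ms = s ->
    br s r (tblk ms sg be) al = tblk ms sg (br s r be al)
}.

(* k[Rep_N(A)], presented by generators a_ij and relations: formal commutative-algebra
   expressions modulo the least congruence containing the axioms of commutative
   unital k-algebras and the three families of defining relations.  This
   algebra can be zero (e.g. for A a Weyl algebra in characteristic 0 and
   N > 0), so it is not an instance of the library's [comAlgType] (where
   1 != 0): it is a [comPzRingType] and an [lmodType], with [repalg_scaleAl]
   and [repalg_scaleAr]. *)

Section RepresentationAlgebra.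
Variables (k : comNzRingType) (A : algType k) (N : nat).

Inductive rexp : Type :=
| RGen of A & 'I_N & 'I_N
| RZero
| ROne
| RAdd of rexp & rexp
| ROpp of rexp
| RScale of k & rexp
| RMul of rexp & rexp.

HB.instance Definition _ := gen_eqMixin rexp.
HB.instance Definition _ := gen_choiceMixin rexp.

Inductive rcongr : rexp -> rexp -> Prop :=
| rcongr_refl x : rcongr x x
| rcongr_sym x y : rcongr x y -> rcongr y x
| rcongr_trans x y z : rcongr x y -> rcongr y z -> rcongr x z
| rcongr_add x x' y y' : rcongr x x' -> rcongr y y' ->
    rcongr (RAdd x y) (RAdd x' y')
| rcongr_opp x x' : rcongr x x' -> rcongr (ROpp x) (ROpp x')
| rcongr_scale c x x' : rcongr x x' -> rcongr (RScale c x) (RScale c x')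
| rcongr_mul x x' y y' : rcongr x x' -> rcongr y y' ->
    rcongr (RMul x y) (RMul x' y')
| rcongr_addA x y z : rcongr (RAdd x (RAdd y z)) (RAdd (RAdd x y) z)
| rcongr_addC x y : rcongr (RAdd x y) (RAdd y x)
| rcongr_add0 x : rcongr (RAdd RZero x) x
| rcongr_addN x : rcongr (RAdd (ROpp x) x) RZero
| rcongr_scaleA a b x : rcongr (RScale a (RScale b x)) (RScale (a * b) x)
| rcongr_scale1 x : rcongr (RScale 1 x) x
| rcongr_scaleDr c x y :
    rcongr (RScale c (RAdd x y)) (RAdd (RScale c x) (RScale c y))
| rcongr_scaleDl a b x :
    rcongr (RScale (a + b) x) (RAdd (RScale a x) (RScale b x))
| rcongr_mulA x y z : rcongr (RMul x (RMul y z)) (RMul (RMul x y) z)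
| rcongr_mulC x y : rcongr (RMul x y) (RMul y x)
| rcongr_mul1 x : rcongr (RMul ROne x) x
| rcongr_mulDl x y z : rcongr (RMul (RAdd x y) z) (RAdd (RMul x z) (RMul y z))
| rcongr_scaleAl c x y : rcongr (RScale c (RMul x y)) (RMul (RScale c x) y)
| rcongr_genD c d a b i j :
    rcongr (RGen (c *: a + d *: b) i j)
           (RAdd (RScale c (RGen a i j)) (RScale d (RGen b i j)))
| rcongr_gen1 i j : rcongr (RGen 1 i j) (if i == j then ROne else RZero)
| rcongr_genM a b i j :
    rcongr (RGen (a * b) i j)
           (\big[RAdd/RZero]_(h < N) RMul (RGen a i h) (RGen b h j)).

Definition requiv (x y : rexp) : bool := `[< rcongr x y >].

Lemma requiv_refl : reflexive requiv.
Proof. by move=> x; apply/asboolP/rcongr_refl. Qed.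

Lemma requiv_sym : symmetric requiv.
Proof. by move=> x y; apply/asboolP/asboolP; apply: rcongr_sym. Qed.

Lemma requiv_trans : transitive requiv.
Proof.
by move=> y x z /asboolP xy /asboolP yz; apply/asboolP; apply: rcongr_trans yz.
Qed.

Canonical requiv_equiv := EquivRel requiv requiv_refl requiv_sym requiv_trans.

Definition repalg := {eq_quot requiv}.
HB.instance Definition _ := Choice.on repalg.
HB.instance Definition _ := Quotient.on repalg.

Lemma repalg_eqP x y : \pi_repalg x = \pi_repalg y <-> rcongr x y.
Proof.
have P : reflect (\pi_repalg x = \pi_repalg y) (requiv_equiv x y) by apply: eqmodP.
by split=> [/P/asboolP|xy]; last apply/P/asboolP.
Qed.

Lemma repalg_eq x y : rcongr x y -> \pi_repalg x = \pi_repalg y.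
Proof. by move=> xy; apply/repalg_eqP. Qed.

Lemma repalg_repr x : rcongr (repr (\pi_repalg x)) x.
Proof. by apply/repalg_eqP; rewrite reprK. Qed.

Definition repalg_zero : repalg := lift_cst repalg RZero.
Definition repalg_one : repalg := lift_cst repalg ROne.
Definition repalg_add := lift_op2 repalg RAdd.
Definition repalg_opp := lift_op1 repalg ROpp.
Definition repalg_scale c := lift_op1 repalg (RScale c).
Definition repalg_mul := lift_op2 repalg RMul.

Lemma pi_rzero : repalg_zero = \pi_repalg RZero.
Proof. by unlock repalg_zero. Qed.
Lemma pi_rone : repalg_one = \pi_repalg ROne.
Proof. by unlock repalg_one. Qed.
Lemma pi_radd x y : repalg_add (\pi_repalg x) (\pi_repalg y) = \pi_repalg (RAdd x y).
Proof.
by unlock repalg_add; apply: repalg_eq; apply: rcongr_add;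
  apply: repalg_repr.
Qed.
Lemma pi_ropp x : repalg_opp (\pi_repalg x) = \pi_repalg (ROpp x).
Proof.
by unlock repalg_opp; apply: repalg_eq; apply: rcongr_opp;
  apply: repalg_repr.
Qed.
Lemma pi_rscale c x : repalg_scale c (\pi_repalg x) = \pi_repalg (RScale c x).
Proof.
by unlock repalg_scale; apply: repalg_eq; apply: rcongr_scale;
  apply: repalg_repr.
Qed.
Lemma pi_rmul x y : repalg_mul (\pi_repalg x) (\pi_repalg y) = \pi_repalg (RMul x y).
Proof.
by unlock repalg_mul; apply: repalg_eq; apply: rcongr_mul;
  apply: repalg_repr.
Qed.

Fact repalg_addA : associative repalg_add.
Proof.
elim/quotW=> x; elim/quotW=> y; elim/quotW=> z.
by rewrite !pi_radd; apply: repalg_eq; apply: rcongr_addA.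
Qed.
Fact repalg_addC : commutative repalg_add.
Proof.
elim/quotW=> x; elim/quotW=> y; rewrite !pi_radd.
by apply: repalg_eq; apply: rcongr_addC.
Qed.
Fact repalg_add0 : left_id repalg_zero repalg_add.
Proof. by elim/quotW=> x; rewrite pi_rzero pi_radd; apply: repalg_eq; apply: rcongr_add0. Qed.
Fact repalg_addN : left_inverse repalg_zero repalg_opp repalg_add.
Proof.
by elim/quotW=> x; rewrite pi_rzero pi_ropp pi_radd; apply: repalg_eq; apply: rcongr_addN.
Qed.

HB.instance Definition _ :=
  GRing.isZmodule.Build repalg repalg_addA repalg_addC repalg_add0 repalg_addN.

Fact repalg_mulA : associative repalg_mul.
Proof.
elim/quotW=> x; elim/quotW=> y; elim/quotW=> z.
by rewrite !pi_rmul; apply: repalg_eq; apply: rcongr_mulA.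
Qed.
Fact repalg_mulC : commutative repalg_mul.
Proof.
elim/quotW=> x; elim/quotW=> y; rewrite !pi_rmul.
by apply: repalg_eq; apply: rcongr_mulC.
Qed.
Fact repalg_mul1 : left_id repalg_one repalg_mul.
Proof. by elim/quotW=> x; rewrite pi_rone pi_rmul; apply: repalg_eq; apply: rcongr_mul1. Qed.
Fact repalg_mulDl : left_distributive repalg_mul +%R.
Proof.
elim/quotW=> x; elim/quotW=> y; elim/quotW=> z.
rewrite ![_ + _]pi_radd !pi_rmul [RHS]pi_radd.
by apply: repalg_eq; apply: rcongr_mulDl.
Qed.

HB.instance Definition _ := GRing.Zmodule_isComPzRing.Build repalg
  repalg_mulA repalg_mulC repalg_mul1 repalg_mulDl.

Fact repalg_scaleA a b x :
  repalg_scale a (repalg_scale b x) = repalg_scale (a * b) x.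
Proof.
by elim/quotW: x => x; rewrite !pi_rscale; apply: repalg_eq; apply: rcongr_scaleA.
Qed.
Fact repalg_scale1 : left_id 1 repalg_scale.
Proof. by elim/quotW=> x; rewrite !pi_rscale; apply: repalg_eq; apply: rcongr_scale1. Qed.
Fact repalg_scaleDr : right_distributive repalg_scale +%R.
Proof.
move=> c; elim/quotW=> x; elim/quotW=> y; rewrite ![_ + _]pi_radd !pi_rscale.
by rewrite [RHS]pi_radd; apply: repalg_eq; apply: rcongr_scaleDr.
Qed.
Fact repalg_scaleDl v : {morph repalg_scale^~ v : a b / a + b}.
Proof.
move=> a b; elim/quotW: v => x; rewrite !pi_rscale [RHS]pi_radd.
by apply: repalg_eq; apply: rcongr_scaleDl.
Qed.

HB.instance Definition _ := GRing.Zmodule_isLmodule.Build k repalg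
  repalg_scaleA repalg_scale1 repalg_scaleDr repalg_scaleDl.

Lemma rpi0 : \pi_repalg RZero = 0.
Proof. by rewrite -pi_rzero. Qed.
Lemma rpi1 : \pi_repalg ROne = 1.
Proof. by rewrite -pi_rone. Qed.
Lemma rpiD x y : \pi_repalg (RAdd x y) = \pi_repalg x + \pi_repalg y.
Proof. by rewrite -pi_radd. Qed.
Lemma rpiN x : \pi_repalg (ROpp x) = - \pi_repalg x.
Proof. by rewrite -pi_ropp. Qed.
Lemma rpiM x y : \pi_repalg (RMul x y) = \pi_repalg x * \pi_repalg y.
Proof. by rewrite -pi_rmul. Qed.
Lemma rpiZ c x : \pi_repalg (RScale c x) = c *: \pi_repalg x.
Proof. by rewrite -pi_rscale. Qed.

Fact repalg_scaleAl c (x y : repalg) : c *: (x * y) = (c *: x) * y.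
Proof.
elim/quotW: x => x; elim/quotW: y => y.
rewrite -rpiM -!rpiZ -rpiM.
by apply: repalg_eq; apply: rcongr_scaleAl.
Qed.
Fact repalg_scaleAr c (x y : repalg) : c *: (x * y) = x * (c *: y).
Proof. by rewrite mulrC repalg_scaleAl mulrC. Qed.

Definition rgen (a : A) (i j : 'I_N) : repalg := \pi_repalg (RGen a i j).

Lemma rgen_lin c d a b i j :
  rgen (c *: a + d *: b) i j = c *: rgen a i j + d *: rgen b i j.
Proof.
rewrite /rgen -!rpiZ -rpiD.
by apply: repalg_eq; apply: rcongr_genD.
Qed.

Lemma rgen1 i j : rgen 1 i j = (i == j)%:R.
Proof. by rewrite /rgen (repalg_eq (rcongr_gen1 i j)); case: eqP; rewrite ?rpi1 ?rpi0. Qed.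

Lemma rgenM a b i j : rgen (a * b) i j = \sum_(h < N) rgen a i h * rgen b h j.
Proof.
rewrite /rgen (repalg_eq (rcongr_genM a b i j)).
rewrite (big_morph (fun x => \pi_repalg x) (id1 := 0) (op1 := +%R)) //.
- by apply: eq_bigr => h _; rewrite rpiM.
- exact: rpiD.
- exact: rpi0.
Qed.

Section Substitution.
Variable f : A -> 'I_N -> 'I_N -> repalg.

Fixpoint reval (x : rexp) : repalg :=
  match x with
  | RGen a i j => f a i j
  | RZero => 0
  | ROne => 1
  | RAdd x y => reval x + reval y
  | ROpp x => - reval x
  | RScale c x => c *: reval x
  | RMul x y => reval x * reval y
  end.

(* The algebra endomorphism with a_ij |-> f a i j; meaningless if f does not
   respect the defining relations. *)
Definition rsubst (x : repalg) : repalg := reval (repr x).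

Hypothesis f_lin : forall c d a b i j,
  f (c *: a + d *: b) i j = c *: f a i j + d *: f b i j.
Hypothesis f_1 : forall i j, f 1 i j = (i == j)%:R.
Hypothesis f_mul : forall a b i j,
  f (a * b) i j = \sum_(h < N) f a i h * f b h j.

Lemma reval_congr x y : rcongr x y -> reval x = reval y.
Proof.
elim=> {x y} //=; try by move=> *; congruence.
- by move=> *; rewrite addrA.
- by move=> *; rewrite addrC.
- by move=> *; rewrite add0r.
- by move=> *; rewrite addNr.
- by move=> *; rewrite scalerA.
- by move=> *; rewrite scale1r.
- by move=> *; rewrite scalerDr.
- by move=> *; rewrite scalerDl.
- by move=> *; rewrite mulrA.
- by move=> *; rewrite mulrC.
- by move=> *; rewrite mul1r.
- by move=> *; rewrite mulrDl.
- by move=> *; rewrite repalg_scaleAl.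
- by move=> i j; rewrite f_1; case: (i == j).
- move=> a b i j; rewrite f_mul.
  by rewrite (big_morph reval (id1 := 0) (op1 := +%R)).
Qed.

Lemma rsubst_pi x : rsubst (\pi_repalg x) = reval x.
Proof. exact/reval_congr/repalg_repr. Qed.

Lemma rsubst_gen a i j : rsubst (rgen a i j) = f a i j.
Proof. exact: rsubst_pi. Qed.

Lemma rsubst1 : rsubst 1 = 1.
Proof. by rewrite -{1}rpi1 rsubst_pi. Qed.

Lemma rsubst_linear : linear rsubst.
Proof.
move=> c; elim/quotW=> x; elim/quotW=> y; rewrite -rpiZ -rpiD.
by rewrite !rsubst_pi.
Qed.

Lemma rsubstM : {morph rsubst : x y / x * y}.
Proof.
elim/quotW=> x; elim/quotW=> y.
by rewrite -rpiM !rsubst_pi.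
Qed.

End Substitution.

Definition rcoef n (al : tpow A n) (i j : {ffun 'I_n -> 'I_N}) : repalg :=
  tlift (fun t : {ffun 'I_n -> A} => \prod_(h < n) rgen (t h) (i h) (j h)) al.

Lemma rcoef_multilinear n (i j : {ffun 'I_n -> 'I_N}) :
  multilinear (fun t : {ffun 'I_n -> A} =>
    \prod_(h < n) rgen (t h) (i h) (j h)).
Proof.
move=> t l c x y.
have E a : \prod_(h < n) rgen (fupd t l a h) (i h) (j h)
  = rgen a (i l) (j l) * \prod_(h < n | h != l) rgen (t h) (i h) (j h).
  rewrite (bigD1 l) //= ffunE eqxx; congr (_ * _).
  by apply: eq_bigr => h /negPf hl; rewrite ffunE hl.
rewrite !E repalg_scaleAl -mulrDl; congr (_ * _).
by have := rgen_lin c 1 x y (i l) (j l); rewrite !scale1r.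
Qed.

Lemma rcoef_pure n (t : {ffun 'I_n -> A}) i j :
  rcoef (tpure t) i j = \prod_(h < n) rgen (t h) (i h) (j h).
Proof. exact/tlift_pure/rcoef_multilinear. Qed.

End RepresentationAlgebra.

Arguments repalg {k} A N.

Section GeneralLinearAction.
Variables (k : comUnitRingType) (A : algType k) (N : nat) (g : 'M[k]_N).

Let conj_gen (a : A) (i j : 'I_N) : repalg A N :=
  \sum_(u < N) \sum_(v < N) (invmx g i u * g v j) *: rgen a u v.

(* The action of g, for g invertible. *)
Definition glact : repalg A N -> repalg A N := rsubst conj_gen.

Hypothesis g_unit : g \in unitmx.

Fact glact_lin c d a b i j :
  conj_gen (c *: a + d *: b) i j = c *: conj_gen a i j + d *: conj_gen b i j.
Proof.
rewrite /conj_gen !scaler_sumr -big_split; apply: eq_bigr => u _.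
rewrite !scaler_sumr -big_split; apply: eq_bigr => v _ /=.
by rewrite rgen_lin scalerDr !scalerA !(mulrC (_ * _)).
Qed.

Fact glact_1 i j : conj_gen 1 i j = (i == j)%:R.
Proof.
have := congr1 (fun M : 'M_N => M i j) (mulVmx g_unit); rewrite !mxE => E.
transitivity ((\sum_(u < N) invmx g i u * g u j) *: (1 : repalg A N)).
  rewrite scaler_suml; apply: eq_bigr => u _.
  rewrite (bigD1 u) //= rgen1 eqxx big1 ?addr0 // => v vu.
  by rewrite rgen1 eq_sym (negPf vu) scaler0.
by rewrite E; case: (i == j); rewrite ?scale1r ?scale0r.
Qed.

Fact glact_mul a b i j :
  conj_gen (a * b) i j = \sum_(h < N) conj_gen a i h * conj_gen b h j.
Proof.
pose X w := \sum_(u < N) invmx g i u *: rgen a u w.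
pose Y w := \sum_(v < N) g v j *: rgen b w v.
have EX h : conj_gen a i h = \sum_(w < N) g w h *: X w.
  rewrite /conj_gen exchange_big; apply: eq_bigr => w _.
  rewrite /X scaler_sumr; apply: eq_bigr => u _.
  by rewrite scalerA [g w h * _]mulrC.
have EY h : conj_gen b h j = \sum_(w < N) invmx g h w *: Y w.
  rewrite /conj_gen; apply: eq_bigr => w _.
  by rewrite /Y scaler_sumr; apply: eq_bigr => v _; rewrite scalerA.
have E w w' : \sum_(h < N) g w h * invmx g h w' = (w == w')%:R.
  by have := congr1 (fun M : 'M_N => M w w') (mulmxV g_unit); rewrite !mxE.
transitivity (\sum_(w < N) X w * Y w).
  transitivity (\sum_(u < N) \sum_(v < N) \sum_(w < N)
    (invmx g i u *: rgen a u w) * (g v j *: rgen b w v)).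
    apply: eq_bigr => u _; apply: eq_bigr => v _.
    rewrite rgenM scaler_sumr; apply: eq_bigr => w _.
    by rewrite -repalg_scaleAl -repalg_scaleAr scalerA.
  transitivity (\sum_(u < N) \sum_(w < N) \sum_(v < N)
    (invmx g i u *: rgen a u w) * (g v j *: rgen b w v)).
    by apply: eq_bigr => u _; rewrite exchange_big.
  rewrite exchange_big; apply: eq_bigr => w _.
  rewrite /X mulr_suml; apply: eq_bigr => u _.
  by rewrite /Y mulr_sumr.
transitivity (\sum_(h < N) \sum_(w < N) \sum_(w' < N)
    (g w h * invmx g h w') *: (X w * Y w')).
  rewrite exchange_big; apply: eq_bigr => w _.
  rewrite exchange_big (bigD1 w) //= -scaler_suml E eqxx scale1r.
  rewrite big1 ?addr0 // => w' w'w.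
  by rewrite -scaler_suml E eq_sym (negPf w'w) scale0r.
apply: eq_bigr => h _; rewrite EX EY mulr_suml; apply: eq_bigr => w _.
rewrite mulr_sumr; apply: eq_bigr => w' _.
by rewrite -repalg_scaleAl -repalg_scaleAr scalerA.
Qed.

Lemma glact_gen a i j : glact (rgen a i j) =
  \sum_(u < N) \sum_(v < N) (invmx g i u * g v j) *: rgen a u v.
Proof. exact: rsubst_gen glact_lin glact_1 glact_mul a i j. Qed.

Lemma glact_linear : linear glact.
Proof. exact: rsubst_linear glact_lin glact_1 glact_mul. Qed.

Lemma glact1 : glact 1 = 1.
Proof. exact: rsubst1 glact_lin glact_1 glact_mul. Qed.

Lemma glactM : {morph glact : x y / x * y}.
Proof. exact: rsubstM glact_lin glact_1 glact_mul. Qed.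

End GeneralLinearAction.

Definition lie_bracket (k : nzRingType) (L : lmodType k) (br : L -> L -> L) :
    Prop :=
  [/\ bilinear_for *:%R *:%R br,
      forall x, br x x = 0 &
      forall x y z, br x (br y z) + br y (br z x) + br z (br x y) = 0].

Definition transposed_poisson (k : nzRingType) (B : lmodType k)
    (mul br : B -> B -> B) : Prop :=
  [/\ bilinear_for *:%R *:%R mul, associative mul, commutative mul, lie_bracket br &
      forall z x y, mul z (br x y) *+ 2 = br (mul z x) y + br x (mul z y)].

Definition induced_bracket (k : comNzRingType) (A : algType k)
    (dbr : forall r s : nat, tpow A r -> tpow A s -> tpow A (r + s)) (N : nat)
    (br : repalg A N -> repalg A N -> repalg A N) : Prop :=
  bilinear_for *:%R *:%R br /\
  forall r s (al : tpow A r) (be : tpow A s)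
      (i j : {ffun 'I_r -> 'I_N}) (i' j' : {ffun 'I_s -> 'I_N}),
    (0 < r)%N -> (0 < s)%N ->
    br (rcoef al i j) (rcoef be i' j')
    = rcoef (dbr r s al be) (fcat i i') (fcat j j').

(* Main.v *)
From HB Require Import structures.
From mathcomp Require Import all_boot all_order all_fingroup all_algebra.
From mathcomp Require Import boolp generic_quotient.
From mathcomp Require Import zify ring.
Require Import Defs.

Set Implicit Arguments.
Unset Strict Implicit.
Unset Printing Implicit Defensive.

Import GRing.Theory.
Local Open Scope ring_scope.

(** Bracketing with the unit already determines the whole structure.  By
    [dtp_one] the bracket of 1 with be is 1 (x) d(be), for a linear operator d on
    each tensor power ([ad_one]).  Taking al = 1 in the tensor Leibniz rule
    [dtp_tensl] and deleting the inserted unit, as [dtp_insl] allows, gives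
      2 ga (x) d(be) = {ga, be} + d(ga (x) be)            ([dbr_ad_one]),
    so the bracket is expressed through d.  By skew symmetry, and because d
    commutes with the exchange of two blocks by [dtp_blkr], this gives
      2 d(ga (x) be) = 2 ga (x) d(be) + 2 d(ga) (x) be    ([ad_one_tens]).
    As 2 is invertible, d is the Leibniz extension of its restriction D to A,
    and the bracket is ga (x) D(be) - D(ga) (x) be ([dbr_tder]).  Compatibility
    with multiplication, [dtp_mulr], makes D a derivation of A.  It is unique
    because D(1) = 0, so that the bracket of 1 with a is 1 (x) D(a)
    ([derivation_unique]).

    A derivation D of A induces the derivation a_ij |-> D(a)_ij of the
    representation algebra ([rder]), and alpha |-> alpha_ij turns tensors into
    products and the Leibniz extension of D into [rder].  Hence the induced
    bracket is x D(y) - D(x) y ([rep_bracket]), for which the transposed Poisson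
    axioms are polynomial identities.  It is equivariant because [rder] commutes
    with the action on the generators ([glact_rder]), and unique because the
    elements alpha_ij span ([rcoef_spanT]). *)

(** * Linear functions given by a bare linearity proof *)

(** The operators on tensor powers are plain functions with a proof of
    linearity; this section transfers the additive lemmas to such functions. *)
Section LinearFunctions.
Variables (k : comNzRingType) (U W : lmodType k) (f : U -> W).
Hypothesis f_lin : linear f.

Let g : {linear U -> W} := HB.pack f (GRing.isLinear.Build k U W _ f f_lin).

Lemma lin0 : f 0 = 0.
Proof. exact: (raddf0 g). Qed.
Lemma linD x y : f (x + y) = f x + f y.
Proof. exact: (raddfD g). Qed.
Lemma linB x y : f (x - y) = f x - f y.
Proof. exact: (raddfB g). Qed.
Lemma linZ c x : f (c *: x) = c *: f x.
Proof. by have := f_lin c x 0; rewrite lin0 !addr0. Qed.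
Lemma linMn x n : f (x *+ n) = f x *+ n.
Proof. exact: (raddfMn g). Qed.
Lemma lin_sum n (F : 'I_n -> U) : f (\sum_i F i) = \sum_i f (F i).
Proof. exact: (raddf_sum g). Qed.

End LinearFunctions.

Lemma linear_comp (k : comNzRingType) (U1 U2 U3 : lmodType k)
    (f : U2 -> U3) (g : U1 -> U2) :
  linear f -> linear g -> linear (f \o g).
Proof. by move=> f_lin g_lin c x y /=; rewrite g_lin f_lin. Qed.

(** * Pure tensors indexed by the natural numbers *)

Section IndexedPureTensors.
Variables (k : comNzRingType) (V : lmodType k).

(** Indexing the factors by nat instead of 'I_n makes every structural operation
    on pure tensors a case distinction on an index, blind to casts between equal
    degrees; identities between such operations then reduce to linear
    arithmetic. *)
Definition npure n (F : nat -> V) : tpow V n := tpure [ffun i : 'I_n => F i].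

Lemma eq_npure n (F G : nat -> V) :
  (forall i, (i < n)%N -> F i = G i) -> npure n F = npure n G.
Proof.
by move=> FG; congr tpure; apply/ffunP=> i; rewrite !ffunE; apply: FG.
Qed.

Lemma tpure_npure n (t : {ffun 'I_n -> V}) : exists F, tpure t = npure n F.
Proof.
exists (fun i => if insub i is Some j then t j else 0).
by congr tpure; apply/ffunP=> i; rewrite ffunE valK.
Qed.

(** The way in which all identities between operators are reduced to index
    computations on pure tensors. *)
Lemma linear_tpow_ext (W : lmodType k) n (f g : tpow V n -> W) :
  linear f -> linear g ->
  (forall F, f (npure n F) = g (npure n F)) -> f =1 g.
Proof.
move=> f_lin g_lin fg; apply: tpow_ind => [t||c x y IHx IHy].
- by have [F ->] := tpure_npure t.
- by rewrite !lin0.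
- by rewrite f_lin g_lin IHx IHy.
Qed.

Lemma tcast_linear m n (e : m = n) : linear (@tcast k V m n e).
Proof. by case: n / e. Qed.

Lemma tcast_trans m n p (e : m = n) (e' : n = p) (x : tpow V m) :
  tcast e' (tcast e x) = tcast (etrans e e') x.
Proof. by case: p / e'; case: n / e. Qed.

Lemma tcast_npure m n (e : m = n) F : tcast e (npure m F) = npure n F.
Proof. by case: n / e. Qed.

Lemma tens_linearr m n (x : tpow V m) : linear (tens x : tpow V n -> _).
Proof. exact: (tens_bilinear V m n).2. Qed.

Lemma tens_linearl m n (y : tpow V n) : linear (fun x : tpow V m => tens x y).
Proof. exact: (tens_bilinear V m n).1. Qed.

Lemma tens_npure m n F G :
  tens (npure m F) (npure n G)
  = npure (m + n) (fun i => if (i < m)%N then F i else G (i - m)%N).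
Proof.
rewrite tens_pure; congr tpure; apply/ffunP=> i; rewrite !ffunE.
by case: splitP => j ->; rewrite ffunE ?addKn.
Qed.

Lemma tins_linear n p (b : V) : linear (@tins k V n p b).
Proof. exact/tlift_linear/tins_multilinear. Qed.

Lemma tins_npure n p (b : V) F : (p <= n)%N ->
  tins p b (npure n F)
  = npure n.+1 (fun i => if (i < p)%N then F i
                         else if i == p then b else F i.-1).
Proof.
move=> pn; rewrite tins_pure; congr tpure; apply/ffunP=> i; rewrite !ffunE.
case: unliftP => [j ->|->]; last by rewrite inordK // ltnn eqxx.
rewrite ffunE /= inordK //.
rewrite /bump; case: leqP => pj; do ?case: ifP => ?; try congr (F _); lia.
Qed.

Lemma tblk_npure l (ms : l.-tuple nat) (s : 'S_l) n F :
  tblk ms s (npure n F)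
  = npure n (fun i => F (nth 0 [seq val j | j <- blkseq ms s (enum 'I_n)] i)).
Proof.
rewrite tblk_pure; congr tpure; apply/ffunP=> i; rewrite !ffunE /blksrc.
rewrite (nth_map i) // (perm_size (perm_blkseq _ _ _)) size_enum_ord.
exact: ltn_ord.
Qed.

Lemma tblk_sw12_npure m p n F : (m + p <= n)%N ->
  tblk [tuple m; p] sw12 (npure n F)
  = npure n (fun i => if (i < p)%N then F (m + i)%N
                      else if (i < p + m)%N then F (i - p)%N else F i).
Proof.
move=> mpn; rewrite tblk_npure; apply: eq_npure => i i_n.
set E := enum 'I_n; have sE : size E = n by rewrite size_enum_ord.
(* Cut the sequence of indices into the blocks that are exchanged. *)
have := blkseq_sw12 (take m E) (take p (drop m E)) (drop (m + p) E).
rewrite !size_takel ?size_drop ?sE; try lia.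
have -> : take m E ++ take p (drop m E) ++ drop (m + p) E = E.
  by rewrite [(m + p)%N]addnC -drop_drop !cat_take_drop.
move=> ->; rewrite !map_cat !(map_take, map_drop) val_enum_ord.
rewrite !nth_cat !size_takel ?size_drop ?size_iota; try lia.
by do ?case: ifP => ?; rewrite ?nth_take ?nth_drop ?nth_iota;
   try congr (F _); lia.
Qed.

Lemma tblk_sw23_npure m p q n F : (m + p + q <= n)%N ->
  tblk [tuple m; p; q] sw23 (npure n F)
  = npure n (fun i => if (i < m)%N then F i
                      else if (i < m + q)%N then F (i + p)%N
                      else if (i < m + q + p)%N then F (i - q)%N else F i).
Proof.
move=> mpn; rewrite tblk_npure; apply: eq_npure => i i_n.
set E := enum 'I_n; have sE : size E = n by rewrite size_enum_ord.
have := blkseq_sw23 (take m E) (take p (drop m E)) (take q (drop (m + p) E))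
          (drop (m + p + q) E).
rewrite !size_takel ?size_drop ?sE; try lia.
have -> : take m E ++ take p (drop m E) ++ take q (drop (m + p) E) ++
    drop (m + p + q) E = E.
  rewrite [(m + p + q)%N]addnC -(drop_drop E q) cat_take_drop.
  by rewrite [(m + p)%N]addnC -drop_drop !cat_take_drop.
move=> ->; rewrite !map_cat !(map_take, map_drop) val_enum_ord.
rewrite !nth_cat !size_takel ?size_drop ?size_iota; try lia.
by do ?case: ifP => ?; rewrite ?nth_take ?nth_drop ?nth_iota;
   try congr (F _); lia.
Qed.

End IndexedPureTensors.

Section IndexedAlgebraTensors.
Variables (k : comNzRingType) (A : algType k).

Lemma tmulfac_linear n u v : (u < v <= n)%N -> linear (@tmulfac k A n u v).
Proof. by move=> uv; apply/tlift_linear/tmulfac_multilinear. Qed.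

Lemma tmulfac_npure n p (F : nat -> A) : (p < n)%N ->
  tmulfac p p.+1 (npure n.+1 F)
  = npure n (fun i => if (i < p)%N then F i
                      else if i == p then F p * F p.+1 else F i.+1).
Proof.
move=> pn; rewrite tmulfac_pure ?ltnSn //; congr tpure; apply/ffunP=> i.
have i_n := ltn_ord i; rewrite !ffunE /bump !inordK; try lia.
by do ?case: ifP => ? //; try congr (F _); lia.
Qed.

Lemma tone_npure : tone = npure 1 (fun=> 1) :> tpow A 1.
Proof. by congr tpure; apply/ffunP=> i; rewrite !ffunE. Qed.

End IndexedAlgebraTensors.

(** * Inserting, deleting and moving the unit *)

Section TensorIdentities.
Variables (k : comNzRingType) (A : algType k).

(** Multiplying an inserted unit into its right neighbour deletes it, which
    cancels the unit in an identity between tensors. *)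
Lemma tmulfac_tins n p (x : tpow A n) : (p < n)%N ->
  tmulfac p p.+1 (tins p 1 x) = x.
Proof.
move=> pn; move: x; apply: linear_tpow_ext => //.
  by apply/linear_comp/tins_linear/tmulfac_linear; lia.
move=> F; rewrite tins_npure 1?ltnW // tmulfac_npure //.
apply: eq_npure => i i_n.
by do ?case: ifP => ? //; rewrite ?mul1r; try congr (F _); lia.
Qed.

Lemma tmulfac_tone n (x : tpow A n) : (0 < n)%N ->
  tmulfac 0 1 (tens tone x : tpow A n.+1) = x.
Proof.
move=> n0; move: x; apply: linear_tpow_ext => //.
  by apply/linear_comp/tens_linearr/tmulfac_linear; lia.
move=> F; rewrite tone_npure tens_npure tmulfac_npure //.
apply: eq_npure => i i_n.
by do ?case: ifP => ? //; rewrite ?mul1r; try congr (F _); lia.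
Qed.

(** The next three lemmas recognise the terms of [dtp_tensl] at al = 1: in each
    of them the unit sits right after the first t factors. *)
Lemma tens_tone_tins t s (x : tpow A t) (y : tpow A s)
    (e : (t + (1 + s) = (t + s).+1)%N) :
  tcast e (tens x (tens tone y)) = tins t 1 (tens x y).
Proof.
move: x; apply: linear_tpow_ext => [||F].
- exact/linear_comp/tens_linearl/tcast_linear.
- exact/linear_comp/tens_linearl/tins_linear.
move: y; apply: linear_tpow_ext => [||G].
- exact/linear_comp/linear_comp/tens_linearr/tens_linearr/tcast_linear.
- exact/linear_comp/tens_linearr/tins_linear.
rewrite tone_npure !tens_npure tcast_npure tins_npure ?leq_addr //.
apply: eq_npure => i i_n.
by do ?case: ifP => ? //; try congr (_ _); lia.
Qed.

Lemma tens_toner t (x : tpow A t) (e : t.+1 = (t + 1)%N) :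
  tens x tone = tcast e (tins t 1 x).
Proof.
move: x; apply: linear_tpow_ext => [||F].
- exact/tens_linearl.
- exact/linear_comp/tins_linear/tcast_linear.
rewrite tone_npure !tens_npure tins_npure // tcast_npure.
by apply: eq_npure => i i_n; do ?case: ifP => ? //; lia.
Qed.

Lemma tblk_tone t s (x : tpow A (t + s)) (e : (1 + (t + s) = (t + s).+1)%N) :
  tcast e (tblk [tuple 1%N; t] sw12 (tens tone x)) = tins t 1 x.
Proof.
move: x; apply: linear_tpow_ext => [||F].
- exact/linear_comp/linear_comp/tens_linearr/tblk_linear/tcast_linear.
- exact/tins_linear.
rewrite tone_npure !tens_npure tblk_sw12_npure ?leq_add2l ?leq_addr //.
rewrite tcast_npure tins_npure ?leq_addr //; apply: eq_npure => i i_n.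
by do ?case: ifP => ? //; try congr (F _); lia.
Qed.

Lemma tblk_sw12_tens m n (x : tpow A m) (y : tpow A n)
    (e : (m + n = n + m)%N) :
  tcast e (tblk [tuple m; n] sw12 (tens x y)) = tens y x.
Proof.
move: x; apply: linear_tpow_ext => [||F].
- exact/linear_comp/linear_comp/tens_linearl/tblk_linear/tcast_linear.
- exact/tens_linearr.
move: y; apply: linear_tpow_ext => [||G].
- exact/linear_comp/linear_comp/tens_linearr/tblk_linear/tcast_linear.
- exact/tens_linearl.
rewrite !tens_npure tblk_sw12_npure // tcast_npure.
by apply: eq_npure => i i_n; do ?case: ifP => ? //; try congr (_ _); lia.
Qed.

Lemma tblk_sw23_tone m n (x : tpow A (m + n)) :
  tblk [tuple 1%N; m; n] sw23 (tens tone x)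
  = tens tone (tblk [tuple m; n] sw12 x).
Proof.
move: x; apply: linear_tpow_ext => [||F].
- exact/linear_comp/tens_linearr/tblk_linear.
- exact/linear_comp/tblk_linear/tens_linearr.
rewrite tone_npure tblk_sw12_npure // !tens_npure tblk_sw23_npure -?addnA //.
by apply: eq_npure => i i_n; do ?case: ifP => ? //; try congr (F _); lia.
Qed.

Lemma tmulfac_tens_tone n p (x : tpow A n.+1)
    (e : (1 + n.+1 = (1 + n).+1)%N) : (p < n)%N ->
  tmulfac (1 + p) (1 + p).+1 (tcast e (tens tone x))
  = tens tone (tmulfac p p.+1 x).
Proof.
move=> pn; move: x; apply: linear_tpow_ext => [||F].
- apply/linear_comp/linear_comp/tens_linearr/tcast_linear/tmulfac_linear; lia.
- by apply/linear_comp/tmulfac_linear; [apply: tens_linearr | lia].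
rewrite tone_npure tmulfac_npure // !tens_npure tcast_npure tmulfac_npure //.
apply: eq_npure => i i_n; do ?case: ifP => ? //; try congr (F _); try lia.
by congr (F _ * F _); lia.
Qed.

End TensorIdentities.

(** * Tensors of degree one and Leibniz extensions *)

Lemma fcat_lshift X m n (s : {ffun 'I_m -> X}) (t : {ffun 'I_n -> X}) i :
  fcat s t (lshift n i) = s i.
Proof. by rewrite ffunE (unsplitK (inl i)). Qed.

Lemma fcat_rshift X m n (s : {ffun 'I_m -> X}) (t : {ffun 'I_n -> X}) i :
  fcat s t (rshift m i) = t i.
Proof. by rewrite ffunE (unsplitK (inr i)). Qed.

Section DegreeOne.
Variables (k : comNzRingType) (A : algType k).

Definition degree_one (a : A) : tpow A 1 := npure 1 (fun=> a).
Definition factor : tpow A 1 -> A := tlift (fun t : {ffun 'I_1 -> A} => t ord0).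

Lemma factor_multilinear :
  multilinear (fun t : {ffun 'I_1 -> A} => t ord0).
Proof. by move=> t i c u v; rewrite !ffunE (ord1 i). Qed.

Lemma degree_one_linear : linear degree_one.
Proof.
move=> c a b; have E x : degree_one x = tpure (fupd [ffun=> 0] ord0 x).
  by congr tpure; apply/ffunP=> i; rewrite !ffunE (ord1 i).
by rewrite !E tpure_multilinear.
Qed.

Lemma factorK : cancel factor degree_one.
Proof.
move=> x; move: x; apply: linear_tpow_ext => [||F].
- apply: linear_comp degree_one_linear _.
  exact/tlift_linear/factor_multilinear.
- by [].
by rewrite /factor tlift_pure ?ffunE; last exact: factor_multilinear;
   apply: eq_npure => -[].
Qed.

Lemma degree_oneK : cancel degree_one factor.
Proof.
move=> a; rewrite /factor tlift_pure ?ffunE //; exact: factor_multilinear.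
Qed.

End DegreeOne.

Section Derivations.
Variables (k : comNzRingType) (A : algType k).

Lemma tder_linear (D : A -> A) n : linear D -> linear (@tder k A D n).
Proof. by move=> D_lin; apply/tlift_linear/tder_multilinear. Qed.

Lemma tder_tens (D : A -> A) m n (x : tpow A m) (y : tpow A n) : linear D ->
  tder D (tens x y) = tens x (tder D y) + tens (tder D x) y.
Proof.
move=> D_lin; have L p : linear (@tder k A D p) by exact: tder_linear.
have E (s : {ffun 'I_m -> A}) (t : {ffun 'I_n -> A}) :
  tder D (tens (tpure s) (tpure t))
  = tens (tpure s) (tder D (tpure t)) + tens (tder D (tpure s)) (tpure t).
  rewrite tens_pure !tder_pure // big_split_ord addrC.
  rewrite (lin_sum (tens_linearr _)) (lin_sum (tens_linearl _)).
  congr (_ + _); apply: eq_bigr => i _; rewrite tens_pure.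
    by rewrite fcat_updl fcat_lshift.
  by rewrite fcat_updr fcat_rshift.
move: x; apply: linear_tpow_ext.
- exact: linear_comp (L _) (tens_linearl y).
- move=> c u v; rewrite L tens_linearl (tens_linearl y c) scalerDr.
  by rewrite addrACA.
move=> F; move: y; apply: linear_tpow_ext => [||G]; last exact: E.
- exact: linear_comp (L _) (tens_linearr _).
- move=> c u v; rewrite L !tens_linearr scalerDr.
  by rewrite addrACA.
Qed.

End Derivations.

(** * The derivation of an adapted bracket *)

Lemma lift_perm_sw12 : lift_perm ord0 ord0 sw12 = sw23.
Proof.
have lift0 : lift ord0 (ord0 : 'I_2) = inord 1 :> 'I_3.
  by apply: val_inj; rewrite /= inordK.
have lift_max : lift ord0 (ord_max : 'I_2) = ord_max :> 'I_3.
  exact: val_inj.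
have I2 (j : 'I_2) : (j = ord0) + (j = ord_max).
  by case: j => [[|[|//]] ?]; [left | right]; apply: val_inj.
apply/permP=> i; case: (unliftP ord0 i) => [j|] ->; last first.
  by rewrite lift_perm_id tpermD // -val_eqE /= ?inordK.
rewrite lift_perm_lift; case: (I2 j) => -> {j}.
  by rewrite tpermL lift0 lift_max tpermL.
by rewrite tpermR lift0 lift_max tpermR.
Qed.

Section Adapted.
Variables (k : comNzRingType) (A : algType k).
Variable dbr : forall r s : nat, tpow A r -> tpow A s -> tpow A (r + s).
Hypothesis dbrP : id_adapted_dtp dbr.

(** The operator d of the bracket {1, be} = 1 (x) d(be); multiplying the first two
    factors together deletes the leading unit. *)
Definition ad_one n (be : tpow A n) : tpow A n :=
  tmulfac 0 1 (dbr tone be : tpow A n.+1).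

Lemma ad_oneE n (be : tpow A n) : (0 < n)%N ->
  dbr tone be = tens tone (ad_one be).
Proof.
by move=> n0; rewrite /ad_one; have [x ->] := dtp_one dbrP be n0;
  rewrite tmulfac_tone.
Qed.

Lemma ad_one_linear n : (0 < n)%N -> linear (@ad_one n).
Proof.
move=> n0; apply: linear_comp; first exact: tmulfac_linear.
exact: (dtp_bilinear dbrP (ltn0Sn 0) n0).2.
Qed.

Lemma ad_one_tcast m n (e : m = n) (x : tpow A m) :
  ad_one (tcast e x) = tcast e (ad_one x).
Proof. by case: n / e. Qed.

(** [dtp_blkr] at al = 1, whose block of length one is then deleted. *)
Lemma ad_one_sw12 m n (x : tpow A (m + n)) : (0 < m)%N -> (0 < n)%N ->
  ad_one (tblk [tuple m; n] sw12 x)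
  = tblk [tuple m; n] sw12 (ad_one x).
Proof.
move=> m0 n0; have mn0 : (0 < m + n)%N by rewrite addn_gt0 m0.
rewrite {1}/ad_one (dtp_blkr dbrP) //=; last by rewrite addn0.
  rewrite ad_oneE // lift_perm_sw12.
  have -> : [tuple of 1%N :: [tuple m; n]] = [tuple 1%N; m; n].
    exact: val_inj.
  by rewrite tblk_sw23_tone tmulfac_tone.
by rewrite m0 n0.
Qed.

(** [dtp_tensl] at al = 1.  All three terms have a unit at position r, the one
    with the bracket by [dtp_insl]; deleting it gives the identity. *)
Lemma dbr_ad_one r s (al : tpow A r) (be : tpow A s) :
  (0 < r)%N -> (0 < s)%N ->
  tens al (ad_one be) *+ 2 = dbr al be + ad_one (tens al be).
Proof.
move=> r0 s0; have rs0 : (0 < r + s)%N by rewrite addn_gt0 r0.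
have e1 : (r + (1 + s) = (r + s).+1)%N by rewrite addnA addn1.
have := dtp_tensl dbrP tone be al (ltn0Sn 0) s0 r0.
rewrite !ad_oneE ?addn_gt0 ?r0 //.
rewrite (tens_toner al (esym (addn1 r))).
move/(congr1 (tcast e1)); rewrite (linMn (tcast_linear e1)).
rewrite (linD (tcast_linear e1)) tens_tone_tins !tcast_trans tblk_tone.
set u := tcast _ _; have -> : u = tins r 1 (dbr al be).
  rewrite -(dtp_insl dbrP al be r0 s0 (leqnn r)) {}/u.
  (* Both sides are casts of the same bracket along equal degrees. *)
  move: (addn1 r) (etrans _ _) (addSn r s) => e2.
  by case: _ / (esym e2) => e3 e4; rewrite (eq_irrelevance e3 e4).
move/(congr1 (tmulfac r r.+1)).
have L : linear (@tmulfac k A (r + s) r r.+1) by apply: tmulfac_linear; lia.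
by rewrite (linMn L) (linD L) !tmulfac_tins //; lia.
Qed.

(** Skew symmetry, with both brackets expressed by [dbr_ad_one], equates
    2 al (x) d(be) - d(al (x) be) with d(al (x) be) - 2 d(al) (x) be. *)
Lemma ad_one_tens r s (al : tpow A r) (be : tpow A s) :
  injective (fun x : tpow A (r + s) => x *+ 2) ->
  (0 < r)%N -> (0 < s)%N ->
  ad_one (tens al be) = tens al (ad_one be) + tens (ad_one al) be.
Proof.
move=> inj2 r0 s0; apply: inj2.
have := dtp_skew dbrP al be r0 s0.
have := dbr_ad_one al be r0 s0; have := dbr_ad_one be al s0 r0.
move/eqP; rewrite -subr_eq => /eqP <-; move/eqP; rewrite -subr_eq => /eqP <-.
pose L1 := @tcast_linear k A _ _ (addnC s r).
pose L2 := tblk_linear [tuple s; r] sw12 (n := s + r) (V := A).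
rewrite (linB L2) (linMn L2) (linB L1) (linMn L1).
rewrite -ad_one_sw12 // -ad_one_tcast !tblk_sw12_tens.
rewrite opprB => /eqP; rewrite subr_eq => /eqP E.
rewrite [LHS]mulr2n mulrnDl [tens al _ *+ 2]E.
by rewrite [RHS]addrAC subrK.
Qed.

Definition ad_one_base (a : A) : A := factor (ad_one (degree_one a)).

Lemma ad_one_base_linear : linear ad_one_base.
Proof.
rewrite /ad_one_base => c a b; rewrite degree_one_linear ad_one_linear //.
exact/tlift_linear/factor_multilinear.
Qed.

Lemma tder_degree_one a :
  tder ad_one_base (degree_one a) = degree_one (ad_one_base a).
Proof.
rewrite tder_pure; last exact: ad_one_base_linear.
rewrite big_ord1; congr tpure; apply/ffunP=> i.
by rewrite !ffunE (ord1 i).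
Qed.

Lemma ad_one_degree_one a :
  ad_one (degree_one a) = degree_one (ad_one_base a).
Proof. by rewrite factorK. Qed.

Section CharacteristicNotTwo.
Hypothesis double_inj : forall n, injective (fun x : tpow A n => x *+ 2).

(** By induction on the degree, splitting off the first factor with
    [ad_one_tens]. *)
Lemma ad_one_tder n (x : tpow A n) : (0 < n)%N ->
  ad_one x = tder ad_one_base x.
Proof.
case: n x => // n x _; have D_lin := ad_one_base_linear.
move: x; apply: linear_tpow_ext; [exact: ad_one_linear|exact: tder_linear|].
elim: n => [|n IH] F.
  have -> : npure 1 F = degree_one (F 0%N) by apply: eq_npure => -[].
  by rewrite tder_degree_one ad_one_degree_one.
have -> : npure n.+2 F
    = tens (degree_one (F 0%N)) (npure n.+1 (fun i => F i.+1)).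
  rewrite tens_npure; apply: eq_npure => i _.
  by case: i => // i; rewrite subn1.
rewrite [LHS](@ad_one_tens 1 n.+1) // [RHS](@tder_tens _ _ _ 1 n.+1) // IH.
by rewrite tder_degree_one ad_one_degree_one.
Qed.

(** A product is the image of a tensor of degree two under the multiplication,
    with which d commutes by [dtp_mulr]; there d obeys the Leibniz rule. *)
Lemma ad_one_base_derivation : derivation ad_one_base.
Proof.
split=> [|a b]; first exact: ad_one_base_linear.
apply: (can_inj (@degree_oneK k A)); rewrite -ad_one_degree_one.
have mul x y : degree_one (x * y)
    = tmulfac 0 1 (tens (degree_one x) (degree_one y) : tpow A 2).
  by rewrite tens_npure tmulfac_npure //; apply: eq_npure => -[].
rewrite mul {1}/ad_one (dtp_mulr dbrP) // ad_oneE //.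
rewrite (tmulfac_tens_tone (n := 1) (p := 0)) // tmulfac_tone //.
rewrite [ad_one _](@ad_one_tens 1 1) // !ad_one_degree_one.
have L : linear (@tmulfac k A 1 0 1) by apply: tmulfac_linear.
by rewrite (linD L) -!mul -(linD (@degree_one_linear k A)).
Qed.

Lemma dbr_tder r s (al : tpow A r) (be : tpow A s) : (0 < r)%N -> (0 < s)%N ->
  dbr al be = tens al (tder ad_one_base be) - tens (tder ad_one_base al) be.
Proof.
move=> r0 s0; have := dbr_ad_one al be r0 s0; rewrite ad_one_tens //.
rewrite !ad_one_tder // => /esym/(canRL (addrK _)) ->.
by rewrite mulr2n opprD addrACA subrr add0r.
Qed.

End CharacteristicNotTwo.
End Adapted.

Lemma derivation1 (k : comNzRingType) (A : algType k) (D : A -> A) :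
  derivation D -> D 1 = 0.
Proof.
case=> _ /(_ 1 1); rewrite !mul1r mulr1 => /eqP.
by rewrite -subr_eq subrr => /eqP.
Qed.

(** As D(1) = 0, the bracket of 1 with a is 1 (x) D(a), and this determines
    D(a). *)
Lemma derivation_unique (k : comNzRingType) (A : algType k) (D D' : A -> A) :
  derivation D -> derivation D' ->
  (forall be : tpow A 1,
     tens tone (tder D be) - tens (tder D tone) be
     = tens tone (tder D' be) - tens (tder D' tone) be) -> D = D'.
Proof.
move=> DP D'P E; apply/funext => a.
have one (d : A -> A) : derivation d -> tder d (tone : tpow A 1) = 0.
  move=> dP; have [d_lin _] := dP; rewrite tder_pure // big_ord1 ffunE.
  rewrite derivation1 //.
  exact: (lin0 (tpure_multilinear [ffun=> 1] ord0)).
have [D_lin _] := DP; have [D'_lin _] := D'P.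
move: (E (degree_one a)); rewrite !one //.
rewrite !(lin0 (tens_linearl _)) !subr0.
move/(congr1 (@tmulfac k A 1 0 1)); rewrite !tmulfac_tone //.
rewrite !tder_pure // !big_ord1 !ffunE.
move/(congr1 (@factor k A)).
rewrite /factor !tlift_pure; [|exact: factor_multilinear..].
by rewrite !ffunE.
Qed.

(** * The induced derivation of the representation algebra *)

Lemma repalg_ind (k : comNzRingType) (A : algType k) N
    (P : repalg A N -> Prop) :
  (forall a i j, P (rgen a i j)) -> P 0 -> P 1 ->
  (forall x y, P x -> P y -> P (x + y)) ->
  (forall c x, P x -> P (c *: x)) ->
  (forall x y, P x -> P y -> P (x * y)) -> forall x, P x.
Proof.
move=> Pgen P0 P1 PD PZ PM; elim/quotW.
elim=> [a i j|||x Px y Py|x Px|c x Px|x Px y Py].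
- exact: Pgen.
- by rewrite rpi0.
- by rewrite rpi1.
- by rewrite rpiD; apply: PD.
- by rewrite rpiN -scaleN1r; apply: PZ.
- by rewrite rpiZ; apply: PZ.
- by rewrite rpiM; apply: PM.
Qed.

Section InducedDerivation.
Variables (k : comNzRingType) (A : algType k) (N : nat) (D : A -> A).
Hypothesis DP : derivation D.

Local Notation B := (repalg A N).

Lemma rgenD (a b : A) i j : rgen (a + b) i j = rgen a i j + rgen b i j :> B.
Proof. by have := rgen_lin (N := N) 1 1 a b i j; rewrite !scale1r. Qed.

Lemma rgen0 i j : rgen 0 i j = 0 :> B.
Proof.
by have := rgen_lin (N := N) 0 0 (0 : A) 0 i j; rewrite !scale0r !addr0.
Qed.

(** The derivation is defined on formal expressions by the Leibniz rule, with
    values in the quotient, and descends because each defining relation is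
    respected. *)
Fixpoint rder_exp (x : rexp A N) : B :=
  match x with
  | RGen a i j => rgen (D a) i j
  | RZero => 0
  | ROne => 0
  | RAdd x y => rder_exp x + rder_exp y
  | ROpp x => - rder_exp x
  | RScale c x => c *: rder_exp x
  | RMul x y => \pi_B%qT x * rder_exp y + rder_exp x * \pi_B%qT y
  end.

Definition rder (x : B) : B := rder_exp (repr x).

(** The relations on generators use, in turn, that D is linear, that D(1) = 0
    and that D obeys the Leibniz rule; the other relations are the axioms of a
    commutative algebra, to which the Leibniz rule extends consistently. *)
Lemma rder_exp_congr x y : rcongr x y -> rder_exp x = rder_exp y.
Proof.
have [D_lin D_mul] := DP.
elim=> {x y} //=; try by move=> *; congruence.
- by move=> x x' y y' xx' -> yy' ->; rewrite (repalg_eq xx') (repalg_eq yy').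
- by move=> *; rewrite addrA.
- by move=> *; rewrite addrC.
- by move=> *; rewrite add0r.
- by move=> *; rewrite addNr.
- by move=> *; rewrite scalerA.
- by move=> *; rewrite scale1r.
- by move=> *; rewrite scalerDr.
- by move=> *; rewrite scalerDl.
- by move=> x y z; rewrite !rpiM; ring.
- by move=> x y; ring.
- by move=> x; rewrite rpi1; ring.
- by move=> x y z; rewrite !rpiD; ring.
- by move=> c x y; rewrite rpiZ scalerDr !repalg_scaleAl.
- by move=> c d a b i j; rewrite D_lin (linZ D_lin) rgen_lin.
- by move=> i j; rewrite derivation1 // rgen0; case: (i == j).
- move=> a b i j; rewrite D_mul rgenD !rgenM.
  rewrite (big_morph rder_exp (id1 := 0) (op1 := +%R)) //= -big_split.
  by apply: eq_bigr.
Qed.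

Lemma rder_pi x : rder (\pi_B%qT x) = rder_exp x.
Proof. exact/rder_exp_congr/repalg_repr. Qed.

Lemma rder_gen a i j : rder (rgen a i j) = rgen (D a) i j.
Proof. exact: rder_pi. Qed.

Lemma rder1 : rder 1 = 0.
Proof. by rewrite -rpi1 rder_pi. Qed.

Lemma rder_linear : linear rder.
Proof.
by move=> c; elim/quotW=> x; elim/quotW=> y; rewrite -rpiZ -rpiD !rder_pi.
Qed.

Lemma rderM x y : rder (x * y) = x * rder y + rder x * y.
Proof.
by elim/quotW: x => x; elim/quotW: y => y; rewrite -rpiM !rder_pi.
Qed.

Definition rep_bracket (x y : B) : B := x * rder y - rder x * y.

Lemma rep_bracket_bilinear : bilinear_for *:%R *:%R rep_bracket.
Proof.
split=> [y|x] c u v /=; rewrite /rep_bracket rder_linear.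
  rewrite scalerBr !repalg_scaleAl; ring.
rewrite scalerBr !repalg_scaleAr; ring.
Qed.

Lemma rep_bracket_transposed_poisson :
  transposed_poisson (fun x y : B => x * y) rep_bracket.
Proof.
split.
- split=> [y|x] c u v /=; first by rewrite mulrDl repalg_scaleAl.
  by rewrite mulrDr repalg_scaleAr.
- exact: mulrA.
- exact: mulrC.
- split=> [|x|x y z]; first exact: rep_bracket_bilinear.
    by rewrite /rep_bracket; ring.
  by rewrite /rep_bracket !(linB rder_linear) !rderM; ring.
- by move=> z x y; rewrite /rep_bracket !rderM; ring.
Qed.

Lemma rcoef_linear n (i j : {ffun 'I_n -> 'I_N}) :
  linear (fun x : tpow A n => rcoef x i j).
Proof. exact/tlift_linear/rcoef_multilinear. Qed.

(** Together with [rder_rcoef] this sends al (x) D(be) - D(al) (x) be to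
    [rep_bracket] of the images of al and be. *)
Lemma rcoef_tens m n (x : tpow A m) (y : tpow A n)
  (i j : {ffun 'I_m -> 'I_N}) (i' j' : {ffun 'I_n -> 'I_N}) :
  rcoef (tens x y) (fcat i i') (fcat j j') = rcoef x i j * rcoef y i' j'.
Proof.
move: x; apply: linear_tpow_ext => [||F].
- exact: linear_comp (rcoef_linear _ _) (tens_linearl y).
- by move=> c u v; rewrite rcoef_linear mulrDl repalg_scaleAl.
move: y; apply: linear_tpow_ext => [||G].
- exact: linear_comp (rcoef_linear _ _) (tens_linearr _).
- by move=> c u v; rewrite rcoef_linear mulrDr repalg_scaleAr.
rewrite tens_pure !rcoef_pure big_split_ord /=; congr (_ * _).
  by apply: eq_bigr => h _; rewrite !fcat_lshift.
by apply: eq_bigr => h _; rewrite !fcat_rshift.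
Qed.

Lemma rder_prod n (F : 'I_n -> B) :
  rder (\prod_h F h)
  = \sum_(l < n) \prod_h (if h == l then rder (F h) else F h).
Proof.
elim: n F => [|n IH] F.
  by rewrite !big_ord0 rder1.
rewrite !big_ord_recl rderM IH addrC eqxx; congr (_ * _ + _).
rewrite mulr_sumr; apply: eq_bigr => l _; rewrite big_ord_recl.
by congr (_ * _); apply: eq_bigr => h _; rewrite (inj_eq lift_inj).
Qed.

Lemma rder_rcoef n (x : tpow A n) (i j : {ffun 'I_n -> 'I_N}) :
  rder (rcoef x i j) = rcoef (tder D x) i j.
Proof.
have [D_lin _] := DP; have L := tder_linear D_lin.
move: x; apply: linear_tpow_ext => [||F].
- exact: linear_comp rder_linear (rcoef_linear _ _).
- exact: linear_comp (rcoef_linear _ _) (L _).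
rewrite tder_pure // (lin_sum (rcoef_linear i j)) rcoef_pure rder_prod.
apply: eq_bigr => l _; rewrite rcoef_pure; apply: eq_bigr => h _.
by rewrite [fupd _ _ _ _]ffunE; case: eqP => [->|//]; rewrite rder_gen.
Qed.

End InducedDerivation.

Section Equivariance.
Variables (k : comUnitRingType) (A : algType k) (N : nat) (D : A -> A).
Hypothesis DP : derivation D.

(** On generators both sides are sums of D(a)_uv with constant coefficients; the
    two maps are derivations along the automorphism given by g. *)
Lemma glact_rder (g : 'M[k]_N) (x : repalg A N) : g \in unitmx ->
  glact g (rder D x) = rder D (glact g x).
Proof.
move=> gU; elim/repalg_ind: x => [a i j||| x y IHx IHy|c x IHx|x y IHx IHy].
- rewrite rder_gen // !glact_gen // (lin_sum (rder_linear DP)).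
  apply: eq_bigr => u _; rewrite (lin_sum (rder_linear DP)).
  by apply: eq_bigr => v _; rewrite (linZ (rder_linear DP)) rder_gen.
- by rewrite !(lin0 (rder_linear DP), lin0 (glact_linear gU)).
- by rewrite glact1 // rder1 // (lin0 (glact_linear gU)).
- by rewrite !(linD (rder_linear DP), linD (glact_linear gU)) IHx IHy.
- by rewrite !(linZ (rder_linear DP), linZ (glact_linear gU)) IHx.
- by rewrite rderM // (linD (glact_linear gU)) !glactM // rderM // IHx IHy.
Qed.

Lemma glact_rep_bracket (g : 'M[k]_N) (x y : repalg A N) : g \in unitmx ->
  glact g (rep_bracket D x y) = rep_bracket D (glact g x) (glact g y).
Proof.
move=> gU; rewrite /rep_bracket (linB (glact_linear gU)) !glactM //.
by rewrite !glact_rder.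
Qed.

End Equivariance.

(** * Uniqueness of the induced bracket *)

Section Span.
Variables (k : comNzRingType) (A : algType k) (N : nat).

Inductive rcoef_span : repalg A N -> Prop :=
| span_rcoef n (x : tpow A n) i j : (0 < n)%N -> rcoef_span (rcoef x i j)
| span_zero : rcoef_span 0
| span_lin c x y : rcoef_span x -> rcoef_span y -> rcoef_span (c *: x + y).

(** The span is a subalgebra because products of the alpha_ij come from tensor
    products, by [rcoef_tens]. *)
Lemma rcoef_spanM x y : rcoef_span x -> rcoef_span y -> rcoef_span (x * y).
Proof.
elim=> {x} [m x i j m0||c x x' _ IHx _ IHx']; last 2 first.
- by rewrite mul0r => _; apply: span_zero.
- move=> y_span; rewrite mulrDl -repalg_scaleAl.
  by apply: span_lin; [apply: IHx | apply: IHx'].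
elim=> {y} [n y i' j' n0||c y y' _ IHy _ IHy']; last 2 first.
- by rewrite mulr0; apply: span_zero.
- by rewrite mulrDr -repalg_scaleAr; apply: span_lin.
by rewrite -rcoef_tens; apply: span_rcoef; rewrite addn_gt0 m0.
Qed.

Lemma rcoef_spanT x : (0 < N)%N -> rcoef_span x.
Proof.
move=> N0; have span_gen a i j : rcoef_span (rgen a i j).
  have -> : rgen a i j = rcoef (degree_one a) [ffun=> i] [ffun=> j].
    by rewrite rcoef_pure big_ord1 !ffunE.
  exact: span_rcoef.
elim/repalg_ind: x => [a i j||| x y|c x x_span|x y].
- exact: span_gen.
- exact: span_zero.
  (* 1 is the diagonal generator 1_00, available in a positive degree since
     0 < N. *)
- have := span_gen 1 (Ordinal N0) (Ordinal N0).
  by rewrite rgen1 eqxx.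
- by rewrite -[x in x + y]scale1r; apply: span_lin.
- by rewrite -[_ *: _]addr0; apply: span_lin x_span span_zero.
- exact: rcoef_spanM.
Qed.

Lemma bilinear_rcoef_ext (f g : repalg A N -> repalg A N -> repalg A N) :
  (0 < N)%N ->
  bilinear_for *:%R *:%R f -> bilinear_for *:%R *:%R g ->
  (forall r s (al : tpow A r) (be : tpow A s) i j i' j',
    (0 < r)%N -> (0 < s)%N ->
    f (rcoef al i j) (rcoef be i' j') = g (rcoef al i j) (rcoef be i' j')) ->
  f = g.
Proof.
move=> N0 [f_linl f_linr] [g_linl g_linr] fg.
apply/funext => x; apply/funext => y.
elim: (rcoef_spanT x N0) => {x} [m x i j m0||c x x' _ IHx _ IHx'].
- elim: (rcoef_spanT y N0) => {y} [n y i' j' n0||c y y' _ IHy _ IHy'].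
  + exact: fg.
  + by rewrite (lin0 (f_linr _)) (lin0 (g_linr _)).
  + by rewrite f_linr g_linr IHy IHy'.
- by rewrite (lin0 (f_linl y)) (lin0 (g_linl y)).
- by rewrite (f_linl y) (g_linl y) IHx IHx'.
Qed.

End Span.

(** * Classification of the brackets and the structure on representations *)

Theorem theoremA (k : closedFieldType) (char0 : [pchar k] =i pred0)
    (A : algType k)
    (dbr : forall r s : nat, tpow A r -> tpow A s -> tpow A (r + s))
    (dbrP : id_adapted_dtp dbr) :
  (exists! D : A -> A,
     derivation D /\
     forall (r s : nat) (al : tpow A r) (be : tpow A s),
       (0 < r)%N -> (0 < s)%N ->
       dbr r s al be = tens al (tder D be) - tens (tder D al) be)
  /\
  (forall N : nat, (0 < N)%N ->
     exists br : repalg A N -> repalg A N -> repalg A N,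
       [/\ unique (induced_bracket dbr (N := N)) br,
           transposed_poisson (fun x y : repalg A N => x * y) br &
           forall (g : 'M[k]_N) (x y : repalg A N), g \in unitmx ->
             glact g (br x y) = br (glact g x) (glact g y)]).
Proof.
have double_inj n : injective (fun x : tpow A n => x *+ 2).
  move=> x y; rewrite -!scaler_nat; apply: scalerI.
  by have := char0 2; rewrite !inE /= => ->.
pose D := ad_one_base dbr.
have DP : derivation D by apply: ad_one_base_derivation dbrP double_inj.
have dbrE r s (al : tpow A r) (be : tpow A s) : (0 < r)%N -> (0 < s)%N ->
    dbr r s al be = tens al (tder D be) - tens (tder D al) be.
  exact: dbr_tder.
split=> [|N N0].
  exists D; split=> // D' [D'P dbrE']; apply: derivation_unique => // be.
  by rewrite -dbrE // -dbrE'.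
have brP : induced_bracket dbr (rep_bracket (N := N) D).
  split=> [|r s al be i j i' j' r0 s0]; first exact: rep_bracket_bilinear.
  rewrite dbrE // (linB (rcoef_linear _ _)).
  by rewrite !rcoef_tens -!rder_rcoef.
exists (rep_bracket (N := N) D); split.
- split=> // br [br_bil brE]; apply: bilinear_rcoef_ext => //.
    exact: brP.1.
  by move=> r s al be i j i' j' r0 s0; rewrite brE // brP.2.
- exact: rep_bracket_transposed_poisson.
- by move=> g x y gU; apply: glact_rep_bracket.
Qed.
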